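(* Let $\Omega\subseteq\mathbb{R}^{n}$ be nonempty, open and bounded. For each $p\in(0,1)$ there exists a constant $c_p>0$, depending only on $n$, $\Omega$ and $p$, such that every smooth function $u:\Omega\to\mathbb{R}$ satisfying $\Delta u\geq 1$ on $\Omega$ satisfies $$\|u\|_{L^p(\Omega)}\geq c_p.$$
   Context: For $0<p<1$, $\|u\|_{L^p(\Omega)}=\left(\int_\Omega|u(x)|^p\,dx\right)^{1/p}\in[0,\infty]$ is the $L^p$ quasi-norm. *)

(* Defs.v *)
From HB Require Import structures.
From mathcomp Require Import all_boot all_order all_algebra.
From mathcomp Require Import all_classical all_reals all_analysis.

Set Implicit Arguments.
Unset Strict Implicit.
Unset Printing Implicit Defensive.

Import Order.TTheory GRing.Theory Num.Theory.
Import numFieldNormedType.Exports.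

Local Open Scope classical_set_scope.
Local Open Scope ring_scope.

(* 'rV[R]_n carries the n-fold product of the Borel sigma-algebra of R, i.e.
   the sigma-algebra generated by the coordinate maps. *)
Definition rV_display : measure_display.
Proof. exact: default_measure_display. Qed.

Section measurable_rV.
Context {R : realType} (n : nat).

Let coord (i : 'I_n) (v : 'rV[R]_n) : R := v ord0 i.

Let rV_set0 : g_sigma_preimage coord set0.
Proof. exact: sigma_algebra0. Qed.

Let rV_setC A : g_sigma_preimage coord A -> g_sigma_preimage coord (~` A).
Proof. exact: sigma_algebraC. Qed.

Let rV_bigcup (F : (set 'rV[R]_n)^nat) :
  (forall i, g_sigma_preimage coord (F i)) ->
  g_sigma_preimage coord (\bigcup_i (F i)).
Proof. exact: sigma_algebra_bigcup. Qed.

HB.instance Definition _ := @isMeasurable.Build rV_display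
  'rV[R]_n (g_sigma_preimage coord) rV_set0 rV_setC rV_bigcup.

End measurable_rV.

Lemma measurable_rV_coord (R : realType) n (i : 'I_n) :
  measurable_fun [set: 'rV[R]_n] (fun v => v ord0 i).
Proof.
move=> _ Y mY; rewrite setTI; apply: sub_sigma_algebra => /=.
rewrite -bigcup_seq/=; exists i => /=; first by rewrite mem_index_enum.
by exists Y => //; rewrite setTI.
Qed.

Lemma measurable_fun_rVP d (T : measurableType d) (R : realType) n
    (f : T -> 'rV[R]_n) :
  measurable_fun [set: T] f <->
  forall i, measurable_fun [set: T] (fun t => f t ord0 i).
Proof.
split=> [mf i|mf]; first exact: measurableT_comp (measurable_rV_coord i) mf.
move=> _ A mA; rewrite setTI.
pose G := [set B | measurable (f @^-1` B)].
suff : @measurable _ 'rV[R]_n `<=` G by apply.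
apply: smallest_sub.
  split=> [|B|F].
  - by rewrite /G/= preimage_set0; exact: measurable0.
  - by rewrite /G/= setTD preimage_setC; exact: measurableC.
  - by rewrite /G/= preimage_bigcup => mF; exact: bigcup_measurable.
rewrite -bigcup_seq => B [i _ [C mC <-]].
by rewrite /G/= setTI -[X in measurable X]setTI; exact: mf.
Qed.

Section lebesgue_measure_rV.
Context {R : realType}.

Definition rV_cons n (xv : measurableTypeR R * 'rV[R]_n) : 'rV[R]_n.+1 :=
  \row_i (if unlift ord0 i is Some j then xv.2 ord0 j else xv.1).

Lemma rV_cons0 n xv : @rV_cons n xv ord0 ord0 = xv.1.
Proof. by rewrite mxE unlift_none. Qed.

Lemma rV_consS n xv j : @rV_cons n xv ord0 (lift ord0 j) = xv.2 ord0 j.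
Proof. by rewrite mxE liftK. Qed.

Lemma measurable_rV_cons n : measurable_fun setT (@rV_cons n).
Proof.
apply/measurable_fun_rVP => i; case: (unliftP ord0 i) => [j|] ->.
  under eq_fun do rewrite rV_consS.
  exact: measurableT_comp (measurable_rV_coord j) measurable_snd.
by under eq_fun do rewrite rV_cons0; exact: measurable_fst.
Qed.

Let rV_uncons n (v : 'rV[R]_n.+1) : measurableTypeR R * 'rV[R]_n :=
  (v ord0 ord0, \row_j v ord0 (lift ord0 j)).

Let rV_consK n : cancel (@rV_cons n) (@rV_uncons n).
Proof.
move=> [x v]; rewrite /rV_uncons rV_cons0; congr pair.
by apply/rowP => j; rewrite mxE rV_consS.
Qed.

Let measurable_rV_uncons n : measurable_fun setT (@rV_uncons n).
Proof.
apply/measurable_fun_pairP; split; first exact: measurable_rV_coord.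
apply/measurable_fun_rVP => j.
by under eq_fun do rewrite mxE; exact: measurable_rV_coord.
Qed.

Section cons_measure.
Context n (mu : {sigma_finite_measure set 'rV[R]_n -> \bar R}).

Definition rV_cons_measure : set 'rV[R]_n.+1 -> \bar R :=
  pushforward (lebesgue_measure \x mu)%E (@rV_cons n).

Let preimage_measurable (A : set 'rV[R]_n.+1) :
  measurable A -> measurable (@rV_cons n @^-1` A).
Proof. by move=> mA; rewrite -[X in measurable X]setTI; exact: measurable_rV_cons. Qed.

Let rV_cons_measure0 : rV_cons_measure set0 = 0%E.
Proof. by rewrite /rV_cons_measure /pushforward preimage_set0 measure0. Qed.

Let rV_cons_measure_ge0 A : (0 <= rV_cons_measure A)%E.
Proof. by rewrite /rV_cons_measure /pushforward measure_ge0. Qed.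

Let rV_cons_measure_sigma_additive : semi_sigma_additive rV_cons_measure.
Proof.
move=> F mF tF mUF; rewrite /rV_cons_measure /pushforward preimage_bigcup.
apply: measure_semi_sigma_additive.
- by move=> k; exact: preimage_measurable.
- apply/trivIsetP => /= i j _ _ ij; rewrite -preimage_setI.
  by move/trivIsetP : tF => /(_ _ _ _ _ ij) ->//; rewrite preimage_set0.
- by rewrite -preimage_bigcup; exact: preimage_measurable.
Qed.

HB.instance Definition _ := isMeasure.Build _ _ _ rV_cons_measure
  rV_cons_measure0 rV_cons_measure_ge0 rV_cons_measure_sigma_additive.

Let rV_cons_measure_sigma_finite : sigma_finite setT rV_cons_measure.
Proof.
have /sigma_finiteP[F [FT ndF Foo]] := sigma_finiteT (@lebesgue_measure R).
have /sigma_finiteP[G [GT ndG Goo]] := sigma_finiteT mu.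
exists (fun k => @rV_uncons n @^-1` (F k `*` G k)).
  rewrite -preimage_bigcup -(preimage_setT (@rV_uncons n)); congr (_ @^-1` _).
  rewrite -setXTT FT GT predeqE => -[x y]; split=> [/= [[k _ Fk] [l _ Gl]]|].
    exists (maxn k l) => //; split.
    - by move: Fk; exact/subsetPset/ndF/leq_maxl.
    - by move: Gl; exact/subsetPset/ndG/leq_maxr.
  by move=> [k _ []/= ? ?]; split; exists k.
move=> k; have [mF Fk] := Foo k; have [mG Gk] := Goo k; split.
  rewrite -[X in measurable X]setTI; apply: measurable_rV_uncons => //.
  exact: measurableX.
rewrite /rV_cons_measure /pushforward -comp_preimage.
rewrite (_ : _ \o _ = id); last by apply/funext => x /=; exact: rV_consK.
by rewrite preimage_id product_measure1E// lte_mul_pinfty// ge0_fin_numE.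
Qed.

HB.instance Definition _ := Measure_isSigmaFinite.Build _ _ _
  rV_cons_measure rV_cons_measure_sigma_finite.

End cons_measure.

(* Lebesgue measure on R^n as the iterated product of the one-dimensional
   Lebesgue measure; R^0 is a single point, of measure 1. *)
Fixpoint lebesgue_measure_rV n :
    {sigma_finite_measure set 'rV[R]_n -> \bar R} :=
  if n is m.+1 then rV_cons_measure (lebesgue_measure_rV m)
  else \d_(0 : 'rV[R]_0).

Lemma lebesgue_measure_rVE n (A : 'I_n -> set (measurableTypeR R)) :
  (forall i, measurable (A i)) ->
  lebesgue_measure_rV n [set x | forall i, A i (x ord0 i)] =
  (\prod_(i < n) lebesgue_measure (A i))%E.
Proof.
elim: n A => [|n IH] A mA.
  rewrite big_ord0 /= diracE mem_set //=.
  by case.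
rewrite big_ord_recl -IH => [|//] /=.
rewrite /rV_cons_measure /pushforward -product_measure1E//; last first.
  rewrite (_ : (fun _ => _) = \bigcap_(i in [set: 'I_n])
      ((fun v : 'rV[R]_n => v ord0 i) @^-1` A (lift ord0 i))).
    apply: fin_bigcap_measurable => //.
    move=> i _; rewrite -[X in measurable X]setTI.
    exact: (@measurable_rV_coord R n i measurableT _ (mA _)).
  by rewrite eqEsubset; split => [x xA i _|x xA i]; [exact: xA|exact: (xA i I)].
congr (_ _); apply/seteqP; split => [[x v] /= xvA|[x v] [/= xA vA] i].
  split=> [|i] /=; first by have := xvA ord0; rewrite rV_cons0.
  by have := xvA (lift ord0 i); rewrite rV_consS.
by case: (unliftP ord0 i) => [k|] ->; rewrite (rV_consS, rV_cons0).
Qed.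

End lebesgue_measure_rV.

(* A function on an open set Omega is represented by a total function on R^n:
   at points of Omega, every notion below depends only on its values in Omega.
   The domain of the L^p quasi-norm is enforced by extending u by 0. *)
Section smooth.
Context {R : realType} {n : nat}.
Implicit Types (u : 'rV[R]_n -> R) (Omega : set 'rV[R]_n).

Definition partial (i : 'I_n) u : 'rV[R]_n -> R :=
  fun x => 'D_(delta_mx ord0 i) u x.

Definition iter_partial (s : seq 'I_n) u : 'rV[R]_n -> R := foldr partial u s.

(* C^oo: partial derivatives of all orders exist and are continuous on Omega. *)
Definition smooth_on Omega u : Prop :=
  forall (s : seq 'I_n) (x : 'rV[R]_n), Omega x ->
    {for x, continuous (iter_partial s u)} /\
    forall i, derivable (iter_partial s u) x (delta_mx ord0 i).

Definition laplacian u : 'rV[R]_n -> R :=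
  fun x => \sum_(i < n) partial i (partial i u) x.

Definition Lp_norm Omega (p : R) u : \bar R :=
  'N[lebesgue_measure_rV n]_p%:E [EFin \o (u \_ Omega)].

Lemma Lp_normE Omega (p : R) u : 0 < p ->
  Lp_norm Omega p u =
  ((\int[lebesgue_measure_rV n]_(x in Omega) (`|u x| `^ p)%:E) `^ p^-1)%E.
Proof.
move=> p0; rewrite /Lp_norm unlock; congr (_ `^ _)%E.
rewrite [RHS]integral_mkcond; apply: eq_integral => x _ /=.
rewrite /patch; case: ifPn => //= _; rewrite normr0 powR0 ?gt_eqF//.
Qed.

End smooth.

(* Main.v *)
Require Import Defs.
From mathcomp Require Import all_boot all_order all_algebra.
From mathcomp Require Import all_classical all_reals all_analysis.
From mathcomp Require Import measurable_realfun ring lra.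

(** The positive part of u obeys an L^p mean value bound even for p < 1: if x0
maximizes u(x) d(x)^k, where d is the distance to the boundary of a cube and
k >= n/p, then u <= 2^k u(x0) on the cube of radius d(x0)/2 about x0, so that
u^+ <= (2^k u(x0))^(1-p) |u|^p there, and the L^1 mean value inequality gives
u(x0)^p d(x0)^n <= C ||u||_p^p.  So if the L^p quasi-norm is small, then u is
bounded above by a small delta on a smaller cube of radius s.  Comparing u with
a paraboloid then gives u <= delta - (s^2 - |x - x1|^2) / (4n), which forces u
to be negative and bounded away from 0 near the centre: the quasi-norm cannot be
small after all.  The mean value inequality comes from the monotonicity in t of
the integral of u(x0 + t y) eta(y), where eta(y) = max(0, 1 - |y|^2) and
- y eta(y) is the gradient of eta(y)^2 / 4. *)

Set Implicit Arguments.
Unset Strict Implicit.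
Unset Printing Implicit Defensive.

Import Order.TTheory GRing.Theory Num.Theory.
Import numFieldNormedType.Exports.

Local Open Scope classical_set_scope.
Local Open Scope ring_scope.

(** * Lebesgue measure on row vectors *)

Lemma rV_norm_leP (R : realType) n (x : 'rV[R]_n) (c : R) : 0 <= c ->
  `|x| <= c <-> forall i, `|x ord0 i| <= c.
Proof.
move=> c0; rewrite /Num.norm/= mx_normrE; split.
  by move=> /bigmax_leP[_ H] i; exact: (H (ord0, i)).
move=> H; apply/bigmax_leP; split => // -[i j] _ /=; rewrite (ord1 i); exact: H.
Qed.

Lemma rV_norm_ltP (R : realType) n (x : 'rV[R]_n) (c : R) : 0 < c ->
  `|x| < c <-> forall i, `|x ord0 i| < c.
Proof.
move=> c0; rewrite /Num.norm/= mx_normrE; split.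
  by move=> /bigmax_ltP[_ H] i; exact: (H (ord0, i)).
move=> H; apply/bigmax_ltP; split => // -[i j] _ /=; rewrite (ord1 i); exact: H.
Qed.

Lemma rV_coord_le_norm (R : realType) n (x : 'rV[R]_n) i : `|x ord0 i| <= `|x|.
Proof. by move: i; apply/rV_norm_leP. Qed.

Lemma measurable_rV_coord_preimage (R : realType) n (A : 'I_n -> set R) :
  (forall i, measurable (A i)) ->
  measurable [set x : 'rV[R]_n | forall i, A i (x ord0 i)].
Proof.
move=> mA.
rewrite (_ : mkset _ = \bigcap_(i in [set: 'I_n])
    ((fun v : 'rV[R]_n => v ord0 i) @^-1` A i)); last first.
  by apply/seteqP; split => [x xA i _|x xA i]; [exact: xA|exact: (xA i I)].
apply: fin_bigcap_measurable => // i _; rewrite -[X in measurable X]setTI.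
exact: (@measurable_rV_coord R n i measurableT _ (mA _)).
Qed.

Lemma measurable_rV_ball (R : realType) n (x : 'rV[R]_n) (e : R) : 0 < e ->
  measurable (ball x e).
Proof.
move=> e0.
rewrite (_ : ball x e = [set y | forall i, ball (x ord0 i) e (y ord0 i)]).
  apply: (@measurable_rV_coord_preimage R n (fun i => ball (x ord0 i) e)).
  by move=> i; rewrite ball_itv; exact: measurable_itv.
apply/seteqP; split => [y|y] /=.
  rewrite -ball_normE /ball_/=; move/(rV_norm_ltP _ e0) => H i; have := H i; rewrite !mxE.
  by rewrite -ball_normE.
move=> H; rewrite -ball_normE /ball_/=.
apply/(rV_norm_ltP _ e0) => i; have := H i.
by rewrite !mxE -ball_normE.
Qed.

(** Measurability refers to the product sigma-algebra, so an open set is written as a countable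
    union of maximum-norm balls, which are boxes, with rational centres and radii 1/(k+1). *)
Lemma open_measurable_rV (R : realType) n (A : set 'rV[R]_n) :
  open A -> measurable A.
Proof.
move=> oA.
pose B (qk : 'rV[rat]_n * nat) : set 'rV[R]_n :=
  [set y | ball (map_mx (@ratr R) qk.1) qk.2.+1%:R^-1 `<=` A /\
           ball (map_mx (@ratr R) qk.1) qk.2.+1%:R^-1 y].
have -> : A = \bigcup_qk B qk.
  apply/seteqP; split => [x Ax|x [qk _ [+]]]; last exact.
  have [e /= e0 xeA] := (nbhs_ballP _ _).1 (open_nbhs_nbhs (conj oA Ax)).
  (* Since 1/(k+1) < e/2, any ball of this radius containing [x] lies in the ball of radius [e]
     about [x]. *)
  have [k _ ke] := near_infty_natSinv_lt (PosNum (divr_gt0 e0 (ltr0n R 2))).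
  have {}ke := ke k (leqnn k); rewrite /= in ke.
  have k0 : 0 < k.+1%:R^-1 :> R by rewrite invr_gt0 ltr0n.
  have /choice[q xq] i : exists q : rat, `|x ord0 i - ratr q| < k.+1%:R^-1 :> R.
    have /rat_in_itvoo[q] : x ord0 i - k.+1%:R^-1 < x ord0 i + k.+1%:R^-1.
      by rewrite ltrD2l gtrN.
    rewrite in_itv/= => /andP[? ?]; exists q.
    by rewrite distrC ltr_distl; exact/andP.
  have Bx : ball (map_mx (@ratr R) (\row_i q i)) k.+1%:R^-1 x.
    apply: ball_sym; rewrite -ball_normE /ball_/=.
    by apply/(rV_norm_ltP _ k0) => i; rewrite !mxE.
  exists (\row_i q i, k) => //; split => //= y yk; apply: xeA.
  by rewrite (splitr e); apply: ball_triangle (ball_sym (le_ball (ltW ke) Bx)) (le_ball (ltW ke) yk).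
apply: countable_bigcupT_measurable => //= qk.
have [qA|qA] := pselect (ball (map_mx (@ratr R) qk.1) qk.2.+1%:R^-1 `<=` A).
  rewrite (_ : B qk = ball (map_mx (@ratr R) qk.1) qk.2.+1%:R^-1).
    by apply: measurable_rV_ball.
  by apply/seteqP; split => [x []|x].
by rewrite (_ : B qk = set0)// -subset0 => x [].
Qed.

Lemma open_continuous_measurable_rV (R : realType) n (A : set 'rV[R]_n)
    (f : 'rV[R]_n -> R) :
  open A -> (forall x, A x -> {for x, continuous f}) -> measurable_fun A f.
Proof.
move=> oA cf; apply: (measurability _ (RGenOpens.measurableE R)).
move=> _ [_ [a [b ->] <-]]; apply: open_measurable_rV.
rewrite openE => x [Ax /= fx]; apply: filterI; first exact: open_nbhs_nbhs.
apply: cf => //; apply: open_nbhs_nbhs; split => //; exact: interval_open.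
Qed.

(** * Affine changes of variables *)

(** By uniqueness of Lebesgue measure: the right-hand side is itself a measure in [A] and gives
    half-open intervals their length. *)
Lemma lebesgue_measure_affine (R : realType) (a c : R)
    (A : set (measurableTypeR R)) : 0 < c -> measurable A ->
  lebesgue_measure A =
    (c%:E * lebesgue_measure ((fun x => a + c * x)%R @^-1` A))%E.
Proof.
move=> c0.
have mphi : measurable_fun setT
    ((fun x => a + c * x) : measurableTypeR R -> measurableTypeR R).
  by apply: (@measurable_funD _ (measurableTypeR R)) => //; exact: measurable_funM.
have [m mE] : exists m : {measure set (measurableTypeR R) -> \bar R},
    forall A, m A = (c%:E * lebesgue_measure ((fun x => a + c * x)%R @^-1` A))%E.
  unshelve eexists (mscale (NngNum (ltW c0)) (pushforward (@lebesgue_measure R)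
    ((fun x => a + c * x) : measurableTypeR R -> measurableTypeR R)));
    by [exact: mphi|].
move=> mA; rewrite -mE; move: A mA.
apply: lebesgue_measure_unique => X [[x y] _ <-]/=.
rewrite mE.
have -> : (fun x0 : R => a + c * x0) @^-1` [set` `]x, y]] =
   `](x - a) / c, (y - a) / c]%classic.
  apply/seteqP; split => z /=; rewrite !in_itv/= ltr_pdivrMr// ler_pdivlMr//;
    by move=> /andP[? ?]; apply/andP; split; lra.
rewrite !lebesgue_measure_itv/= !lte_fin ltr_pM2r ?invr_gt0// ltrD2r.
case: ifPn => xy; last by rewrite mule0.
by rewrite -!EFinB -EFinM; congr EFin; field; rewrite gt_eqF.
Qed.

Lemma ge0_integral_affine (R : realType) (a c : R)
    (f : measurableTypeR R -> \bar R) : 0 < c ->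
  measurable_fun setT f -> (forall x, 0 <= f x)%E ->
  (\int[lebesgue_measure]_x f x =
   c%:E * \int[lebesgue_measure]_x f (a + c * x)%R)%E.
Proof.
move=> c0 mf f0.
have mphi : measurable_fun setT
    ((fun x => a + c * x) : measurableTypeR R -> measurableTypeR R).
  by apply: (@measurable_funD _ (measurableTypeR R)) => //; exact: measurable_funM.
rewrite -(ge0_integral_pushforward mphi lebesgue_measure measurableT)//.
rewrite -[c]/((NngNum (ltW c0))%:num).
rewrite -ge0_integral_mscale//.
apply: eq_measure_integral => A mA _.
exact: lebesgue_measure_affine.
Qed.

(** The measure in dimension n+1 is by construction the image of a product measure under [rV_cons],
    so Tonelli's theorem applies. *)
Lemma ge0_integral_rV_cons (R : realType) n (f : 'rV[R]_n.+1 -> \bar R) :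
  measurable_fun setT f -> (forall x, 0 <= f x)%E ->
  (\int[lebesgue_measure_rV n.+1]_x f x =
   \int[lebesgue_measure]_x \int[lebesgue_measure_rV n]_v f (rV_cons (x, v)))%E.
Proof.
move=> mf f0.
transitivity
    (\int[lebesgue_measure \x lebesgue_measure_rV n]_z f (rV_cons z))%E.
  by rewrite -(ge0_integral_pushforward (@measurable_rV_cons R n) _ measurableT).
rewrite fubini_tonelli1//.
exact: measurableT_comp (@measurable_rV_cons R n).
Qed.

Lemma measurable_fun_rV_affine (R : realType) n (a : 'rV[R]_n) (c : R) :
  measurable_fun setT (fun x : 'rV[R]_n => a + c *: x).
Proof.
apply/measurable_fun_rVP => i.
rewrite (_ : (fun _ => _) = fun x : 'rV[R]_n => a ord0 i + c * x ord0 i).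
  apply: measurable_funD => //; apply: measurable_funM => //.
  exact: measurable_rV_coord.
by apply/funext => x; rewrite !mxE.
Qed.

(** Induction on [n]: with the first coordinate split off, the tail contributes c^n and the
    one-dimensional formula the remaining factor c. *)
Lemma ge0_integral_rV_affine (R : realType) n (a : 'rV[R]_n) (c : R)
    (f : 'rV[R]_n -> \bar R) : 0 < c ->
  measurable_fun setT f -> (forall x, 0 <= f x)%E ->
  (\int[lebesgue_measure_rV n]_x f x =
   (c ^+ n)%:E * \int[lebesgue_measure_rV n]_x f (a + c *: x)%R)%E.
Proof.
move=> c0; elim: n a f => [|n IH] a f mf f0.
  rewrite expr0 mul1e; apply: eq_integral => x _; congr f.
  by apply/rowP => -[].
rewrite !ge0_integral_rV_cons//; last first.
  exact: measurableT_comp mf (measurable_fun_rV_affine _ _).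
have mfc x : measurable_fun setT (fun v => f (rV_cons (x, v))).
  apply: (measurableT_comp mf); apply: (measurableT_comp (@measurable_rV_cons R n)).
  exact: measurable_pair1.
under eq_integral do rewrite (IH (\row_j a ord0 (lift ord0 j)))//.
rewrite [LHS](@ge0_integral_affine _ (a ord0 ord0) c)//; last 2 first.
- apply: measurable_funeM.
  pose g (z : measurableTypeR R * 'rV[R]_n) :=
    f (rV_cons (z.1, (\row_j a ord0 (lift ord0 j)) + c *: z.2)).
  apply: (@measurable_fun_fubini_tonelli_F _ _ _ _ _ (lebesgue_measure_rV n) g).
    apply: (measurableT_comp mf).
    apply: (measurableT_comp (@measurable_rV_cons R n)).
    apply/measurable_fun_pairP; split; first exact: measurable_fst.
    exact: measurableT_comp (measurable_fun_rV_affine _ _) measurable_snd.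
  by move=> z; exact: f0.
- by move=> x; rewrite mule_ge0 ?lee_fin ?exprn_ge0 ?(ltW c0)// integral_ge0.
under eq_integral.
  move=> x _.
  under eq_integral.
    move=> v _; rewrite (_ : rV_cons _ = a + c *: rV_cons (x, v)); last first.
      apply/rowP => i; rewrite !mxE; case: unliftP => [j|] ->/=; by rewrite ?mxE.
    over.
  over.
rewrite ge0_integralZl//; first by rewrite muleA -EFinM -exprS.
- apply: (@measurable_fun_fubini_tonelli_F _ _ _ _ _ (lebesgue_measure_rV n)
    (fun z => f (a + c *: rV_cons z))) => [|z]; last exact: f0.
  apply: (measurableT_comp mf).
  exact: measurableT_comp (measurable_fun_rV_affine _ _) (@measurable_rV_cons R n).
- by move=> x _; exact: integral_ge0.
- by rewrite lee_fin exprn_ge0 ?ltW.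
Qed.

(** * Directional derivatives *)

(** Both difference quotients are the same function of h, so directional derivatives reduce to
    derivatives in one real variable. *)
Lemma is_derive_lineP (R : realType) (V : normedModType R) (f : V -> R)
    (x v : V) (t d : R) :
  is_derive (x + t *: v) v f d <->
  is_derive t 1 (fun s : R => f (x + s *: v)) d.
Proof.
have E : (fun h : R => h^-1 *: ((f \o shift (x + t *: v)) (h *: v) -
                                f (x + t *: v))) =
    (fun h : R => h^-1 *: (((fun s : R => f (x + s *: v)) \o shift t) (h *: 1) -
                           f (x + t *: v))).
  apply/funext => h /=; congr (_ *: (f _ - _)).
  by rewrite [h *: 1]mulr1 scalerDl addrCA.
split=> -[df dE]; apply: DeriveDef; move: df dE; rewrite /derivable /derive.
- by rewrite E.
- by rewrite E.
- by rewrite E.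
- by rewrite E.
Qed.

Lemma is_derive_line0P (R : realType) (V : normedModType R) (f : V -> R)
    (x v : V) (d : R) :
  is_derive x v f d <-> is_derive (0 : R) 1 (fun s : R => f (x + s *: v)) d.
Proof. by rewrite -is_derive_lineP scale0r addr0. Qed.

(** A division-free criterion: the remainder can be estimated by polynomial inequalities in h. *)
Lemma is_derive1_littleo (R : realType) (g : R -> R) (t d : R) :
  (forall e, 0 < e -> \forall h \near (0 : R), `|g (t + h) - g t - h * d| <= e * `|h|) ->
  is_derive t 1 g d.
Proof.
move=> H.
have dg : h^-1 *: ((g \o shift t) (h *: 1) - g t) @[h --> 0^'] --> d.
  apply/cvgrPdist_le => e e0; near=> h.
  have h0 : h != 0 by near: h; exact: nbhs_dnbhs_neq.
  rewrite /= [h *: 1]mulr1 [_ *: _]mulrC distrC.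
  rewrite -(ler_pM2r (_ : 0 < `|h|)) ?normr_gt0// -normrM mulrBl divfK//.
  rewrite (mulrC d) (addrC h); near: h.
  by apply: nbhs_dnbhs; exact: H.
apply: DeriveDef; first by apply/cvg_ex; exists d.
exact: cvg_lim dg.
Unshelve. all: by end_near. Qed.

(* The increment along c e, based at x + h w, is handled by the mean value
theorem; this is how continuous partial derivatives give all directional
derivatives. *)
Lemma is_derive_addZ (R : realType) (V : normedModType R) (f : V -> R)
    (x w e : V) (c dw : R) :
  (\forall y \near x, derivable f y e) ->
  {for x, continuous (fun y => 'D_e f y)} ->
  is_derive x w f dw ->
  is_derive x (w + c *: e) f (dw + c * 'D_e f x).
Proof.
move=> fe ce dwf.
(* The mean value theorem on [0, 1] along the segment from x + h w to x + h (w + c e). *)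
have mvt h : (forall s : R, 0 <= s <= 1 ->
      derivable f (x + h *: w + (h * c * s) *: e) e) ->
    exists2 s : R, 0 <= s <= 1 &
    f (x + h *: (w + c *: e)) - f (x + h *: w) =
    h * c * 'D_e f (x + h *: w + (h * c * s) *: e).
  move=> df.
  pose g (s : R) := f (x + h *: w + (h * c * s) *: e).
  have dg (s : R) : 0 <= s <= 1 ->
      is_derive s 1 g ('D_e f (x + h *: w + (h * c * s) *: e) * (h * c)).
    move=> s01.
    have H1 : is_derive (h * c * s) 1
        (fun t : R => f (x + h *: w + t *: e))
        ('D_e f (x + h *: w + (h * c * s) *: e)).
      have := derivableP (df s s01).
      by move=> /(is_derive_lineP f (x + h *: w) e (h * c * s) _).1.
    have H2 : is_derive s 1 (fun t : R => h * c * t) (h * c).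
      apply: is_derive1_littleo => eps /ltW eps0; near=> k.
      rewrite (_ : _ - _ - _ = 0); last by ring.
      by rewrite normr0 mulr_ge0.
    exact: is_derive1_comp H1 H2.
  have [s| |s s01 gE] := @MVT_segment R g
      (fun s => 'D_e f (x + h *: w + (h * c * s) *: e) * (h * c)) 0 1 ler01.
  - by rewrite in_itv/= => /andP[? ?]; apply: dg; rewrite !ltW.
  - apply: derivable_within_continuous => s; rewrite in_itv/= => /dg sg.
    exact: (@ex_derive _ _ _ _ _ _ _ sg).
  - rewrite in_itv/= in s01; exists s => //; move: gE.
    rewrite /g subr0 mulr1 mulr0 scale0r addr0 mulr1 => gE'.
    by rewrite [RHS]mulrC -gE' scalerDr scalerA addrA.
apply/is_derive_line0P.
(* The first summand is differentiated by hypothesis; the second, the increment along [e], vanishes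
   at s = 0 and has derivative [c * 'D_e f x] there. *)
rewrite (_ : (fun s => _) = (fun s => f (x + s *: w)) +
   (fun s => f (x + s *: (w + c *: e)) - f (x + s *: w))); last first.
  by apply/funext => s; rewrite !fctE addrC subrK.
apply: is_deriveD; first exact: (is_derive_line0P f x w dw).1 dwf.
apply: is_derive1_littleo => eps eps0.
(* Dividing by |c| + 1 instead of |c| covers the case c = 0. *)
have c1 : 0 < `|c| + 1 by rewrite ltr_wpDl.
have ec0 : 0 < eps / (`|c| + 1) by rewrite divr_gt0.
move/cvgrPdist_le : ce => /(_ _ ec0) ce.
have [d /= d0 dP] := (nbhs_ballP _ _).1 (filterI fe ce).
near=> h.
(* For such h the segment used in [mvt] stays in the ball where [f] is derivable along [e] and its
   derivative is within eps / (|c| + 1) of the value at [x]. *)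
have hd : `|h| * (`|w| + `|c| * `|e| + 1) < d.
  rewrite -ltr_pdivlMr ?ltr_wpDl ?addr_ge0 ?mulr_ge0//.
  near: h; apply: (@cvgr0_norm_lt _ R^o); first exact: cvg_id.
  by rewrite divr_gt0 ?ltr_wpDl ?addr_ge0 ?mulr_ge0.
have inball (s : R) : 0 <= s <= 1 -> ball x d (x + h *: w + (h * c * s) *: e).
  move=> /andP[s0 s1].
  rewrite -ball_normE /ball_/= -addrA opprD addNKr normrN.
  apply: le_lt_trans hd; apply: le_trans (ler_normD _ _) _.
  rewrite !normrZ -addrA !mulrDr lerD2l ler_wpDr ?mulr_ge0//.
  rewrite (ger0_norm s0) mulrA ler_wpM2r//.
  by rewrite ler_piMr// mulr_ge0.
rewrite add0r !scale0r addr0 subrr subr0.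
have [|s s01 ->] := mvt h; first by move=> s /inball /dP[].
have [_ /= sb] := dP _ (inball s s01).
rewrite -mulrA -mulrBr normrM mulrC ler_wpM2r// -mulrBr normrM distrC.
apply: le_trans (ler_wpM2l (normr_ge0 _) sb) _.
rewrite mulrCA ler_piMr ?(ltW eps0)// ler_pdivrMr// mul1r.
by rewrite lerDl.
Unshelve. all: by end_near. Qed.

(** Expand [v] in the standard basis and add the coordinate directions one at a time, starting from
    the zero vector. *)
Lemma is_derive_rV (R : realType) n (f : 'rV[R]_n -> R) (x v : 'rV[R]_n) :
  (forall i, \forall y \near x, derivable f y (delta_mx ord0 i)) ->
  (forall i, {for x, continuous (partial i f)}) ->
  is_derive x v f (\sum_(i < n) v ord0 i * partial i f x).
Proof.
move=> df cf; rewrite {1}(row_sum_delta v).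
elim: (index_enum _) => [|i s IH].
  by rewrite !big_nil; exact: is_derive0.
rewrite !big_cons [_ *: _ + _]addrC [_ * _ + _]addrC.
exact: (@is_derive_addZ R _ f x _ (delta_mx ord0 i) (v ord0 i) _ (df i) (cf i) IH).
Qed.

(** * The kernel *)

(** The squared Euclidean norm; [|y|] on row vectors is the maximum norm, whose balls are cubes. *)
Definition sqnorm (R : realType) n (y : 'rV[R]_n) : R :=
  \sum_(i < n) y ord0 i ^+ 2.

(** The kernel eta of the mean value inequality. It is supported in the closed Euclidean unit ball,
    hence in the cube [|y| <= 1]. *)
Definition parab (R : realType) n (y : 'rV[R]_n) : R :=
  Num.max 0 (1 - sqnorm y).

Lemma sqnorm_ge0 (R : realType) n (y : 'rV[R]_n) : 0 <= sqnorm y.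
Proof. by apply: sumr_ge0 => i _; exact: sqr_ge0. Qed.

Lemma sqnorm_coord (R : realType) n (y : 'rV[R]_n) i : y ord0 i ^+ 2 <= sqnorm y.
Proof.
by rewrite /sqnorm (bigD1 i)//= lerDl sumr_ge0// => j _; exact: sqr_ge0.
Qed.

Lemma sqnorm_ge1 (R : realType) n (y : 'rV[R]_n) : 1 <= `|y| -> 1 <= sqnorm y.
Proof.
rewrite leNgt => /negP y1; rewrite leNgt; apply/negP => q1; apply: y1.
apply/rV_norm_ltP => // i; rewrite -(@expr_lt1 _ 2)//.
by rewrite real_normK ?num_real// (le_lt_trans (sqnorm_coord y i)).
Qed.

Lemma continuous_sumr (R : realType) (T : topologicalType) (I : Type)
    (r : seq I) (F : I -> T -> R) (x : T) :
  (forall i, {for x, continuous (F i)}) ->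
  {for x, continuous (fun y => \sum_(i <- r) F i y)}.
Proof.
move=> cF; rewrite /prop_for/= /continuous_at; elim: r => [|i r IH].
  by rewrite big_nil; under eq_fun do rewrite big_nil; exact: cvg_cst.
rewrite big_cons; under eq_fun do rewrite big_cons.
by apply: cvgD => //; exact: cF.
Qed.

Lemma continuous_sqnorm (R : realType) n : continuous (@sqnorm R n).
Proof.
move=> y; apply: continuous_sumr => i.
by apply: (@continuous_comp _ _ _ (fun y : 'rV[R]_n => y ord0 i) (fun x : R => x ^+ 2));
   [exact: coord_continuous|exact: exprn_continuous].
Qed.

Lemma parab_ge0 (R : realType) n (y : 'rV[R]_n) : 0 <= parab y.
Proof. by rewrite /parab le_max lexx. Qed.

Lemma parab_le1 (R : realType) n (y : 'rV[R]_n) : parab y <= 1.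
Proof. by rewrite /parab ge_max ler01 gerBl sqnorm_ge0. Qed.

Lemma parab_eq0 (R : realType) n (y : 'rV[R]_n) : 1 <= `|y| -> parab y = 0.
Proof. by move=> /sqnorm_ge1 y1; rewrite /parab max_l// subr_le0. Qed.

Lemma continuous_parab (R : realType) n : continuous (@parab R n).
Proof.
move=> y.
apply: (@continuous_max _ _ (cst 0) (fun y : 'rV[R]_n => 1 - sqnorm y) y).
  exact: cst_continuous.
apply: continuousB; first exact: cst_continuous.
exact: continuous_sqnorm.
Qed.

Lemma sqnorm_addZ (R : realType) n (y : 'rV[R]_n) i (h : R) :
  sqnorm (y + h *: delta_mx ord0 i) = sqnorm y + (h * y ord0 i) *+ 2 + h ^+ 2.
Proof.
rewrite /sqnorm (bigD1 i)//= [in RHS](bigD1 i)//=.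
rewrite !mxE !eqxx mulr1 (eq_bigr (fun j => y ord0 j ^+ 2)) => [|j ji].
  by rewrite mulr2n; ring.
by rewrite !mxE eqxx (negbTE ji) mulr0 addr0.
Qed.

(** The square of a positive part is C^1, with derivative twice the positive part, even where 1 -
    |y|^2 changes sign. Hence the field - y eta(y) is a gradient on the whole space, and integration
    by parts produces no boundary term. *)
Lemma is_derive_parab2 (R : realType) n (y : 'rV[R]_n) i :
  is_derive y (delta_mx ord0 i) (fun z => parab z ^+ 2 / 4) (- (y ord0 i * parab y)).
Proof.
(* First-order expansion of the squared positive part, with remainder at most k^2 in each of the
   four sign cases. *)
have max2 (s k : R) : `|Num.max 0 (s + k) ^+ 2 - Num.max 0 s ^+ 2 - k * (2 * Num.max 0 s)| <= k ^+ 2.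
  have [|] := leP 0 s => s0; have [|] := leP 0 (s + k) => k0; rewrite ler_norml;
    apply/andP; split; nra.
apply/is_derive_line0P/is_derive1_littleo => e e0; near=> h.
rewrite add0r scale0r addr0 /parab sqnorm_addZ.
have -> : 1 - (sqnorm y + (h * y ord0 i) *+ 2 + h ^+ 2) =
  (1 - sqnorm y) + (- (h * y ord0 i) *+ 2 - h ^+ 2) by rewrite mulr2n; ring.
set s := 1 - sqnorm y; set k := (_ - h ^+ 2); set yi := y ord0 i.
have m1 : `|Num.max 0 s| <= 1.
  by rewrite ger0_norm ?parab_ge0// parab_le1.
have := max2 s k; set m := Num.max 0 (s + k); move: m1; set m0 := Num.max 0 s.
move=> m1 H.
have h1 : `|h| <= 1 by near: h; apply: (@cvgr0_norm_le _ R^o); [exact: cvg_id|].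
(* The square controls k^2 / h^2, and the 2 accounts for the term 2 m0 h^2, where |m0| <= 1. *)
have hC : `|h| * ((2 * `|yi| + 1) ^+ 2 + 2) <= e.
  rewrite -ler_pdivlMr ?ltr_wpDl ?sqr_ge0//.
  near: h; apply: (@cvgr0_norm_le _ R^o); first exact: cvg_id.
  by rewrite divr_gt0 ?ltr_wpDl ?sqr_ge0.
have kh : `|k| <= `|h| * (2 * `|yi| + 1).
  apply: le_trans (ler_normB _ _) _.
  rewrite normrMn normrN normrM normrX mulr2n.
  have := normr_ge0 h; have := normr_ge0 yi; nra.
have k2 : k ^+ 2 <= `|h| ^+ 2 * (2 * `|yi| + 1) ^+ 2.
  by rewrite -exprMn -[k ^+ 2]real_normK ?num_real// lerXn2r ?nnegrE ?mulr_ge0 ?addr_ge0 ?mulr_ge0.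
have -> : m ^+ 2 / 4 - m0 ^+ 2 / 4 - h * - (yi * m0) =
    ((m ^+ 2 - m0 ^+ 2 - k * (2 * m0)) - 2 * m0 * h ^+ 2) / 4.
  have kE : k = - (2 * h * yi) - h ^+ 2 by rewrite /k /yi mulr2n; ring.
  by move: kE H k2; clearbody k m m0 yi => -> _ _; field.
rewrite normrM [`|4^-1|]ger0_norm// ler_pdivrMr//.
apply: le_trans (ler_normB _ _) _.
rewrite [`|_ * h ^+ 2|]normrM [`|2 * _|]normrM normr_nat normrX.
have := normr_ge0 h; move: H k2 hC m1; set a := `|h|; set b := `|m0|.
set X := `|_ - _ - _|; set Y := (2 * `|yi| + 1) ^+ 2 => H k2 hC m1 a0.
have : b * a ^+ 2 <= a ^+ 2 by rewrite ler_piMl ?sqr_ge0.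
have : a * (a * (Y + 2)) <= a * e by rewrite ler_wpM2l.
nra.
Unshelve. all: by end_near. Qed.

(** * Cubes and translation invariance *)

Lemma rV_cubeE (R : realType) n (r : R) : 0 <= r ->
  [set y : 'rV[R]_n | `|y| <= r] =
  [set y | forall i, `[- r, r]%classic (y ord0 i)].
Proof.
move=> r0; apply/seteqP; split => y /=.
  by move=> /(rV_norm_leP y r0) H i; have := H i; rewrite ler_norml in_itv.
move=> H; apply/rV_norm_leP => // i; have := H i.
by rewrite ler_norml in_itv.
Qed.

Lemma measurable_rV_cube (R : realType) n (r : R) : 0 <= r ->
  measurable [set y : 'rV[R]_n | `|y| <= r].
Proof.
move=> r0; rewrite rV_cubeE//.
by apply: (@measurable_rV_coord_preimage R n (fun=> `[- r, r]%classic)).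
Qed.

Lemma lebesgue_rV_cube (R : realType) n (r : R) : 0 < r ->
  lebesgue_measure_rV n [set y : 'rV[R]_n | `|y| <= r] = ((2 * r) ^+ n)%:E.
Proof.
move=> r0; rewrite rV_cubeE ?ltW//.
rewrite (@lebesgue_measure_rVE R n (fun=> `[- r, r]%classic))//.
have -> : lebesgue_measure (`[- r, r]%classic : set (measurableTypeR R)) =
    (2 * r)%:E.
  by rewrite lebesgue_measure_itv/= lte_fin gtrN// -EFinB opprK mulr_natl mulr2n.
rewrite big_const card_ord; elim: n => [|n IH]; first by rewrite expr0.
by rewrite iterS IH exprS EFinM.
Qed.

Lemma compact_rV_cube (R : realType) n (x : 'rV[R]_n) (r : R) :
  0 < r -> compact [set y : 'rV[R]_n | `|y - x| <= r].
Proof.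
move=> r0; apply: bounded_closed_compact.
  exists (`|x| + r); split; first by rewrite num_real.
  move=> M rM y /= yr; apply: le_trans (ltW rM).
  by rewrite -(subrK x y) addrC (le_trans (ler_normD _ _))// lerD2l.
rewrite (_ : mkset _ = closed_ball x r); first exact: closed_ball_closed.
rewrite closed_ballE//.
by apply/seteqP; split => y /=; rewrite /closed_ball_/= distrC.
Qed.

Lemma integral_rV_translate (R : realType) n (a : 'rV[R]_n)
    (f : 'rV[R]_n -> \bar R) : measurable_fun setT f ->
  (\int[lebesgue_measure_rV n]_x f (a + x)%R =
   \int[lebesgue_measure_rV n]_x f x)%E.
Proof.
move=> mf; rewrite integralE [RHS]integralE; congr (_ - _)%E.
- rewrite [RHS](@ge0_integral_rV_affine _ _ a 1)//; last exact: measurable_funepos.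
  rewrite expr1n mul1e; apply: eq_integral => x _.
  by rewrite ?funeposE ?funenegE scale1r.
- rewrite [RHS](@ge0_integral_rV_affine _ _ a 1)//; last exact: measurable_funeneg.
  rewrite expr1n mul1e; apply: eq_integral => x _.
  by rewrite ?funeposE ?funenegE scale1r.
Qed.

(** * Integration over cubes *)

Lemma continuous_cube_bounded (R : realType) n (x : 'rV[R]_n) (r : R)
    (f : 'rV[R]_n -> R) : 0 < r ->
  (forall y, `|y - x| <= r -> {for y, continuous f}) ->
  exists C : R, forall y, `|y - x| <= r -> `|f y| <= C.
Proof.
move=> r0 cf.
have cfA : {within [set y | `|y - x| <= r], continuous f}.
  by apply: continuous_in_subspaceT => y; rewrite inE => /cf.
have [C [_ HC]] := compact_bounded (continuous_compact cfA (@compact_rV_cube _ _ x _ r0)).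
exists (C + 1) => y yr; apply: (HC (C + 1)); first by rewrite ltrDl.
by exists y.
Qed.

Lemma bounded_cube_integrable (R : realType) n (r C : R) (f : 'rV[R]_n -> R) :
  0 < r -> measurable_fun [set y : 'rV[R]_n | `|y| <= r] f ->
  (forall y, `|y| <= r -> `|f y| <= C) ->
  (lebesgue_measure_rV n).-integrable [set y : 'rV[R]_n | `|y| <= r] (EFin \o f).
Proof.
move=> r0 mf fC; apply: measurable_bounded_integrable => //.
- by apply: measurable_rV_cube; exact: ltW.
- by rewrite [X in (X < _)%E](@lebesgue_rV_cube R n r r0) ltry.
- exists C; split; first by rewrite num_real.
  by move=> M CM y /= /fC /le_trans; apply; exact: ltW.
Qed.

(** Compactness of the cube bounds [f], and the open neighbourhood [V] supplies measurability. *)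
Lemma continuous_cube_integrable (R : realType) n (V : set 'rV[R]_n)
    (f : 'rV[R]_n -> R) :
  open V -> (forall y, `|y| <= 1 -> V y) ->
  (forall y, V y -> {for y, continuous f}) ->
  (lebesgue_measure_rV n).-integrable [set y : 'rV[R]_n | `|y| <= 1] (EFin \o f).
Proof.
move=> oV QV cf.
have [|C HC] := @continuous_cube_bounded R n 0 1 f ltr01.
  by move=> y; rewrite subr0 => /QV; exact: cf.
apply: (@bounded_cube_integrable _ _ _ C) => //; last first.
  by move=> y y1; apply: HC; rewrite subr0.
apply: (@measurable_funS _ _ _ _ V) => //; first exact: open_measurable_rV.
exact: open_continuous_measurable_rV.
Qed.

Lemma rV_norm_delta (R : realType) n (i : 'I_n) :
  `|delta_mx ord0 i : 'rV[R]_n| <= 1.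
Proof.
apply/rV_norm_leP => // j; rewrite mxE.
by case: (_ && _); rewrite ?normr1 ?normr0.
Qed.

Lemma Rintegral_cube_widen (R : realType) n (r s : R) (g : 'rV[R]_n -> R) :
  r <= s -> (forall y, r < `|y| -> g y = 0) ->
  \int[lebesgue_measure_rV n]_(y in [set y | `|y| <= s]) g y =
  \int[lebesgue_measure_rV n]_(y in [set y | `|y| <= r]) g y.
Proof.
move=> rs g0; rewrite Rintegral_mkcond [RHS]Rintegral_mkcond.
congr (Rintegral _ _ _); apply/funext => y; rewrite /patch.
have [yr|yr] := leP `|y| r.
  by rewrite !mem_set//= (le_trans yr).
by rewrite (g0 _ yr); case: ifP; case: ifP.
Qed.

(* By translation invariance, the integral of f (y + s e_i) does not depend on
s; differentiate it at s = 0 under the integral sign. *)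
Lemma Rintegral_partial_eq0 (R : realType) n (i : 'I_n) (f g : 'rV[R]_n -> R)
    (C : R) :
  measurable_fun setT f ->
  (forall y, is_derive y (delta_mx ord0 i) f (g y)) ->
  (forall y, `|f y| <= C) -> (forall y, `|g y| <= C) ->
  (forall y, 1 < `|y| -> f y = 0) -> (forall y, 1 < `|y| -> g y = 0) ->
  \int[lebesgue_measure_rV n]_(y in [set y | `|y| <= 1]) g y = 0.
Proof.
move=> mf df fC gC f0 g0.
set e := delta_mx ord0 i in df.
(* Half-side 2 leaves room for every translate of the unit cube by less than 1. *)
pose F s := \int[lebesgue_measure_rV n]_(y in [set y | `|y| <= 2]) f (y + s *: e).
have out (y : 'rV[R]_n) (s : R) : s \in `]-1, 1[ -> 2 < `|y| -> 1 < `|y + s *: e|.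
  rewrite in_itv/= => /andP[s1 s2] y2.
  have se : `|s *: e| <= 1.
    rewrite normrZ -[leRHS]mulr1 ler_pM// ?rV_norm_delta//.
    by rewrite ler_norml !ltW.
  have := lerB_normD y (s *: e); lra.
have F0 s : s \in `]-1, 1[ -> F s = F 0.
  move=> s1.
  have FT t : t \in `]-1, 1[ -> F t = \int[lebesgue_measure_rV n]_y f y.
    move=> t1; rewrite /F Rintegral_mkcond.
    rewrite (_ : _ \_ _ = fun y => f (t *: e + y)).
      by rewrite /Rintegral (integral_rV_translate (t *: e) (f := EFin \o f))//;
        exact/measurable_EFinP.
    apply/funext => y; rewrite /patch; case: ifPn.
      by rewrite addrC.
    by rewrite notin_setE/= => /negP; rewrite -ltNge => /(out _ _ t1) /f0; rewrite addrC.
  by rewrite !FT// in_itv/= ltrN10 ltr01.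
have mcube : measurable [set y : 'rV[R]_n | `|y| <= 2] by exact: measurable_rV_cube.
have H0 : (`]-1, 1[%classic : set R) 0 by rewrite /= in_itv/= ltrN10 ltr01.
have intf (s : R) : (`]-1, 1[%classic : set R) s -> (lebesgue_measure_rV n).-integrable
    [set y : 'rV[R]_n | `|y| <= 2] (EFin \o (fun y => f (y + s *: e))).
  move=> _; apply: (@bounded_cube_integrable _ _ _ C) => //.
  apply: measurable_funTS; apply: (measurableT_comp mf).
  rewrite (_ : (fun _ => _) = fun y => s *: e + 1 *: y).
    exact: measurable_fun_rV_affine.
  by apply/funext => y; rewrite scale1r addrC.
have dline (s : R) y : is_derive s 1 (fun s => f (y + s *: e)) (g (y + s *: e)).
  exact: (is_derive_lineP f y e s _).1 (df _).
have intG : (lebesgue_measure_rV n).-integrable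
    [set y : 'rV[R]_n | `|y| <= 2] (EFin \o cst C).
  apply: (@bounded_cube_integrable _ _ _ `|C|) => //.
have G0 (y : 'rV[R]_n) : 0 <= cst C y by rewrite /= (le_trans _ (fC 0)).
have pd (s : R) y : partial1of2 (fun s y => f (y + s *: e)) s y = g (y + s *: e).
  by rewrite partial1of2E; exact: (@derive_val _ _ _ _ _ _ _ (dline s y)).
have := @differentiation_under_integral R _ _ (lebesgue_measure_rV n)
  (fun s y => f (y + s *: e)) _ mcube 0 (-1) 1 H0 intf
  (fun s y _ _ => @ex_derive _ _ _ _ _ _ _ (dline s y)) (cst C) G0 intG.
move=> H.
have {}H := H (fun s y _ _ => ltac:(rewrite pd; exact: gC)).
rewrite (@Rintegral_cube_widen _ _ 1 2) in H; last 2 first.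
- by rewrite ler1n.
- by move=> y y1; rewrite pd scale0r addr0 g0.
(* [F] is constant near 0, so its derivative there is 0; computed under the integral sign, the same
   derivative is the integral of [g]. *)
rewrite (_ : \int[_]_(y in _) g y = derive1 F 0).
  rewrite derive1E; apply: derive_val.
  apply: near_eq_is_derive (is_derive_cst (F 0) _ _).
  near=> s; rewrite /= F0//; near: s.
  by apply: near_in_itvoo; rewrite in_itv/= ltrN10 ltr01.
rewrite H; apply: eq_Rintegral => y _.
by rewrite pd scale0r addr0.
Unshelve. all: by end_near. Qed.

Lemma Rintegral_sumr d (T : measurableType d) (R : realType)
    (mu : {measure set T -> \bar R}) (D : set T) (I : Type) (r : seq I)
    (F : I -> T -> R) :
  measurable D -> (forall i, mu.-integrable D (EFin \o F i)) ->
  \int[mu]_(x in D) (\sum_(i <- r) F i x) = \sum_(i <- r) \int[mu]_(x in D) F i x.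
Proof.
move=> mD iF; elim: r => [|i r IH].
  rewrite big_nil; under eq_Rintegral do rewrite big_nil.
  by rewrite Rintegral_cst// mul0r.
rewrite big_cons; under eq_Rintegral do rewrite big_cons.
rewrite RintegralD//; first by rewrite IH.
rewrite (_ : _ \o _ = fun x => (\sum_(j <- r) (F j x)%:E)%E).
  by apply: (@integrable_sum _ _ _ mu D mD _ r xpredT) => j _; exact: iF.
by apply/funext => x /=; rewrite sumEFin.
Qed.

(** * The mean value inequality *)

Lemma smooth_on_is_derive (R : realType) n (Omega : set 'rV[R]_n)
    (u : 'rV[R]_n -> R) (s : seq 'I_n) (x v : 'rV[R]_n) :
  open Omega -> smooth_on Omega u -> Omega x ->
  is_derive x v (iter_partial s u)
    (\sum_(i < n) v ord0 i * iter_partial (i :: s) u x).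
Proof.
move=> oO su Ox; apply: is_derive_rV => i.
  by near=> y; apply: (su s y _).2; near: y; exact: open_nbhs_nbhs.
exact: (su (i :: s) x Ox).1.
Unshelve. all: by end_near. Qed.

Section mean_value.
Context (R : realType) (n : nat) (Omega : set 'rV[R]_n) (u : 'rV[R]_n -> R).
Context (oO : open Omega) (su : smooth_on Omega u) (x0 : 'rV[R]_n) (r : R)
  (ballO : forall z, `|z - x0| < r -> Omega z).

Let mu := lebesgue_measure_rV (R := R) n.
Let Q : set 'rV[R]_n := [set y | `|y| <= 1].

Context (r2 : R) (r20 : 0 < r2) (r2r : r2 < r).

(** An open neighbourhood of the unit cube [Q] on which x0 + t y stays in [Omega] for all |t| <= r2;
    there is room for it because r2 < r. *)
Let V : set 'rV[R]_n := [set y | `|y| < r / r2].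

Let rr2 : 1 < r / r2. Proof. by rewrite ltr_pdivlMr// mul1r. Qed.

Let oV : open V.
Proof.
rewrite (_ : V = ball 0 (r / r2)); first by apply: ball_open; rewrite (lt_trans _ rr2).
by apply/seteqP; split => y /=; rewrite -ball_normE /ball_/= sub0r normrN.
Qed.

Let QV y : Q y -> V y.
Proof. by move=> /le_lt_trans; apply. Qed.

Let inO (t : R) y : `|t| <= r2 -> V y -> Omega (x0 + t *: y).
Proof.
move=> tr2 Vy; apply: ballO; rewrite addrC addKr normrZ.
have [->|t0] := eqVneq t 0; first by rewrite normr0 mul0r (lt_trans r20).
apply: (@le_lt_trans _ _ (r2 * `|y|)); first by rewrite ler_wpM2r.
by rewrite mulrC -ltr_pdivlMr.
Qed.

Let csu (s : seq 'I_n) (t : R) y : `|t| <= r2 -> V y ->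
  {for y, continuous (fun y : 'rV[R]_n => iter_partial s u (x0 + t *: y))}.
Proof.
move=> tr Vy; apply: (@continuous_comp _ _ _ (fun y : 'rV[R]_n => x0 + t *: y)).
  apply: continuousD; first exact: cst_continuous.
  exact: scaler_continuous.
exact: (su s (inO tr Vy)).1.
Qed.

(** The points x0 + t y all lie in the compact cube of radius [r2] about [x0]. These uniform bounds
    give the dominating constants below. *)
Let bsu (s : seq 'I_n) : exists C : R, forall t y, `|t| <= r2 -> Q y ->
  `|iter_partial s u (x0 + t *: y)| <= C.
Proof.
have [|C HC] := @continuous_cube_bounded R n x0 r2 (iter_partial s u) r20.
  by move=> y yr; apply: (su s _).1; apply: ballO; exact: le_lt_trans r2r.
exists C => t y tr2 Qy; apply: HC; rewrite addrC addKr normrZ -[leRHS]mulr1.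
exact: ler_pM.
Qed.

(** The weighted average of u at scale t, not normalized, pulled back to the unit cube. At t = 0 it
    is [u x0] times the mass of the kernel. *)
Let Phi (t : R) := \int[mu]_(y in Q) (u (x0 + t *: y) * parab y).

Let dPhi_integrand (t : R) (y : 'rV[R]_n) :=
  (\sum_(i < n) y ord0 i * partial i u (x0 + t *: y)) * parab y.

Let mQ : measurable Q. Proof. exact: measurable_rV_cube. Qed.

Let int_Phi (t : R) : `|t| <= r2 ->
  mu.-integrable Q (EFin \o (fun y : 'rV[R]_n => u (x0 + t *: y) * parab y)).
Proof.
move=> tr; apply: (continuous_cube_integrable oV QV) => y Vy.
apply: continuousM; last exact: continuous_parab.
exact: (@csu [::] t y tr Vy).
Qed.

Let int_dPhi (t : R) : `|t| <= r2 ->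
  mu.-integrable Q (EFin \o dPhi_integrand t).
Proof.
move=> tr; apply: (continuous_cube_integrable oV QV) => y Vy.
apply: continuousM; last exact: continuous_parab.
apply: continuous_sumr => i; apply: continuousM; first exact: coord_continuous.
exact: (@csu [:: i] t y tr Vy).
Qed.

Let is_derive_integrand (t : R) (y : 'rV[R]_n) : `|t| < r2 -> Q y ->
  is_derive t 1 (fun t : R => u (x0 + t *: y) * parab y) (dPhi_integrand t y).
Proof.
move=> tr Qy.
have Oy := inO (ltW tr) (QV Qy).
have H := (is_derive_lineP u x0 y t _).1 (smooth_on_is_derive [::] y oO su Oy).
have := is_deriveM H (is_derive_cst (parab y) t 1).
by rewrite scaler0 add0r [_ *: _]mulrC.
Qed.

Let is_derive_Phi (t : R) : `|t| < r2 ->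
  is_derive t 1 Phi (\int[mu]_(y in Q) dPhi_integrand t y).
Proof.
move=> tr.
have /choice[C HC] := fun i => bsu [:: i].
have It : (`]-r2, r2[%classic : set R) t by rewrite /= in_itv/= -ltr_norml.
have tI (s : R) : (`]-r2, r2[%classic : set R) s -> `|s| < r2.
  by rewrite /= in_itv/= -ltr_norml.
have pd (s : R) (y : 'rV[R]_n) : (`]-r2, r2[%classic : set R) s -> Q y ->
    partial1of2 (fun (t : R) (y : 'rV[R]_n) => u (x0 + t *: y) * parab y) s y = dPhi_integrand s y.
  move=> /tI sr Qy; rewrite partial1of2E.
  exact: (@derive_val _ _ _ _ _ _ _ (is_derive_integrand sr Qy)).
(* On [Q] both |y_i| and the kernel are at most 1, so the sum of the bounds on the first partial
   derivatives dominates; the absolute value makes it visibly nonnegative. *)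
pose G (y : 'rV[R]_n) := `|\sum_(i < n) C i|.
have intG : mu.-integrable Q (EFin \o G).
  apply: (@bounded_cube_integrable _ _ _ `|\sum_(i < n) C i|) => //.
    exact: measurable_cst.
  by move=> y _; rewrite /G normr_id.
have G_ub (s : R) (y : 'rV[R]_n) : (`]-r2, r2[%classic : set R) s -> Q y ->
    `|partial1of2 (fun (t : R) (y : 'rV[R]_n) => u (x0 + t *: y) * parab y) s y| <= G y.
  move=> Is Qy; rewrite pd// /dPhi_integrand normrM /G.
  apply: (@le_trans _ _ (\sum_(i < n) C i)); last exact: ler_norm.
  rewrite -[leRHS]mulr1 ler_pM// ?(ger0_norm (parab_ge0 y)) ?parab_le1//.
  apply: le_trans (ler_norm_sum _ _ _) _; apply: ler_sum => i _.
  rewrite normrM -[leRHS]mul1r ler_pM//.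
    by apply: le_trans Qy; exact: rV_coord_le_norm.
  exact: HC (ltW (tI _ Is)) Qy.
have intf (s : R) : (`]-r2, r2[%classic : set R) s ->
    mu.-integrable Q (EFin \o (fun y : 'rV[R]_n => u (x0 + s *: y) * parab y)).
  by move=> /tI /ltW /int_Phi.
have derf (s : R) (y : 'rV[R]_n) : (`]-r2, r2[%classic : set R) s -> Q y ->
    derivable (fun t : R => u (x0 + t *: y) * parab y) s 1.
  by move=> /tI sr Qy; exact: (@ex_derive _ _ _ _ _ _ _ (is_derive_integrand sr Qy)).
have dE := @differentiation_under_integral R _ _ mu
  (fun (t : R) (y : 'rV[R]_n) => u (x0 + t *: y) * parab y) Q mQ t (-r2) r2 It intf derf
  G (fun=> normr_ge0 _) intG G_ub.
have dd := @derivable_under_integral R _ _ mu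
  (fun (t : R) (y : 'rV[R]_n) => u (x0 + t *: y) * parab y) Q mQ t (-r2) r2 It intf derf
  G (fun=> normr_ge0 _) intG G_ub.
apply: DeriveDef => //.
rewrite -derive1E dE; apply: eq_Rintegral => y; rewrite inE => Qy.
exact: pd.
Qed.

(* The derivative along e_i of y |-> partial i u (x0 + t y) * parab y ^+ 2 / 4. *)
Let div_integrand (t : R) (i : 'I_n) (y : 'rV[R]_n) :=
  t * partial i (partial i u) (x0 + t *: y) * (parab y ^+ 2 / 4)
  - partial i u (x0 + t *: y) * (y ord0 i * parab y).

Let int_div (t : R) i : `|t| <= r2 ->
  mu.-integrable Q (EFin \o div_integrand t i).
Proof.
move=> tr; apply: (continuous_cube_integrable oV QV) => y Vy.
apply: continuousB; apply: continuousM.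
- apply: continuousM; first exact: cst_continuous.
  exact: (@csu [:: i; i] t y tr Vy).
- apply: continuousM; last exact: cst_continuous.
  by apply: (@continuous_comp _ _ _ (@parab R n) (fun x : R => x ^+ 2));
    [exact: continuous_parab|exact: exprn_continuous].
- exact: (@csu [:: i] t y tr Vy).
- by apply: continuousM; [exact: coord_continuous|exact: continuous_parab].
Qed.

Let continuous_kernel (y : 'rV[R]_n) :
  {for y, continuous (fun y : 'rV[R]_n => parab y ^+ 2 / 4)}.
Proof.
apply: continuousM; last exact: cst_continuous.
by apply: (@continuous_comp _ _ _ (@parab R n) (fun x : R => x ^+ 2));
  [exact: continuous_parab|exact: exprn_continuous].
Qed.

(** Moving y by s e_i moves x0 + t y by s t e_i, whence the factor t. *)
Let is_derive_partial_scale (t : R) i (y : 'rV[R]_n) : `|t| <= r2 -> V y ->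
  is_derive y (delta_mx ord0 i) (fun y : 'rV[R]_n => partial i u (x0 + t *: y))
    (t * partial i (partial i u) (x0 + t *: y)).
Proof.
move=> tr Vy.
have H := smooth_on_is_derive [:: i] (t *: delta_mx ord0 i) oO su (inO tr Vy).
rewrite (bigD1 i)//= big1 ?addr0 in H; last first.
  by move=> j ji; rewrite !mxE eqxx (negbTE ji) mulr0 mul0r.
rewrite !mxE !eqxx mulr1 in H.
have {}H := (is_derive_line0P (partial i u) _ _ _).1 H.
apply: (is_derive_line0P (fun y : 'rV[R]_n => partial i u (x0 + t *: y)) _ _ _).2.
rewrite (_ : (fun s : R => _) =
  (fun s : R => partial i u (x0 + t *: y + s *: (t *: delta_mx ord0 i))))//.
by apply/funext => s; rewrite scalerDr !scalerA (mulrC t) addrA.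
Qed.

(** Integration by parts: thanks to the factor eta^2, the function being differentiated vanishes
    outside [Q] and is differentiable along e_i everywhere, also across the boundary of [Q]. *)
Let Rintegral_div (t : R) i : `|t| <= r2 ->
  \int[mu]_(y in Q) div_integrand t i y = 0.
Proof.
move=> tr.
have [C1 HC1] := bsu [:: i].
have [C2 HC2] := bsu [:: i; i].
pose f (y : 'rV[R]_n) := partial i u (x0 + t *: y) * (parab y ^+ 2 / 4).
have p0 (y : 'rV[R]_n) : ~ Q y -> parab y = 0.
  by move=> /negP; rewrite -ltNge => /ltW /parab_eq0.
have parab01 (y : 'rV[R]_n) : 0 <= parab y ^+ 2 / 4 <= 1.
  by have := parab_ge0 y; have := parab_le1 y; nra.
(* One constant bounds both the function, by [C1], and its derivative, by [r2 * C2 + C1], on [Q];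
   the maximum with 0 serves the points outside [Q]. *)
apply: (@Rintegral_partial_eq0 R n i f _ (Num.max 0 (r2 * C2 + C1))).
- rewrite (_ : f = f \_ V); last first.
    apply/funext => y; rewrite /patch; case: ifPn => //.
    rewrite notin_setE => nVy; rewrite /f p0; last by move/QV.
    by rewrite expr0n mul0r mulr0.
  apply: (measurable_restrictT f (open_measurable_rV oV)).1.
  apply: (open_continuous_measurable_rV oV) => y Vy.
  rewrite /f; apply: continuousM; last exact: continuous_kernel.
  exact: (@csu [:: i] t y tr Vy).
- move=> y; have [Vy|nVy] := pselect (V y).
    have := is_deriveM (is_derive_partial_scale i tr Vy) (is_derive_parab2 y i).
    congr (is_derive _ _ _ _).
    by rewrite /div_integrand /GRing.scale/=; ring.
  (* Outside [V] the point is at norm greater than 1, so the kernel vanishes in a whole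
     neighbourhood of it. *)
  have y1 : 1 < `|y| by apply: lt_le_trans rr2 _; rewrite leNgt; apply/negP.
  have -> : div_integrand t i y = 0.
    by rewrite /div_integrand parab_eq0 ?ltW// expr0n mul0r !mulr0 subrr.
  apply: near_eq_is_derive (is_derive_cst 0 _ _).
  near=> z; rewrite /f parab_eq0 ?expr0n ?mul0r ?mulr0// ltW//.
  by near: z; apply: (cvgr_gt _ (@norm_continuous R 'rV[R]_n y)).
- move=> y; have [Qy|/p0 y0] := pselect (Q y); last first.
    by rewrite /f y0 expr0n mul0r mulr0 normr0 le_max lexx.
  rewrite le_max; apply/orP; right; rewrite /f normrM.
  have := HC1 _ _ tr Qy; have := HC2 _ _ tr Qy; have /andP[k0 k1] := parab01 y.
  rewrite (ger0_norm k0) /= => b2 b1.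
  apply: (@le_trans _ _ C1); last first.
    by rewrite lerDr mulr_ge0 ?(ltW r20)//; apply: le_trans b2.
  by rewrite -[leRHS]mulr1 ler_pM.
- move=> y; have [Qy|/p0 y0] := pselect (Q y); last first.
    by rewrite /div_integrand y0 expr0n mul0r !mulr0 subrr normr0 le_max lexx.
  rewrite le_max; apply/orP; right; apply: le_trans (ler_normB _ _) _.
  have := HC1 _ _ tr Qy; have := HC2 _ _ tr Qy; have /andP[k0 k1] := parab01 y.
  rewrite [`|_ * (parab y ^+ 2 / 4)|]normrM [`|t * _|]normrM.
  rewrite [`|_ * (y ord0 i * _)|]normrM [`|y ord0 i * _|]normrM.
  rewrite (ger0_norm k0) (ger0_norm (parab_ge0 _)) /= => b2 b1.
  apply: lerD.
    rewrite -[leRHS]mulr1; apply: ler_pM => //.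
    exact: ler_pM.
  rewrite -[leRHS]mulr1; apply: ler_pM => //.
    by rewrite mulr_ge0// parab_ge0.
  rewrite -[leRHS]mulr1; apply: ler_pM; rewrite ?parab_ge0 ?parab_le1//.
  by apply: le_trans Qy; exact: rV_coord_le_norm.
- move=> y /ltW /parab_eq0 y0.
  by rewrite /f y0 expr0n mul0r mulr0.
- move=> y /ltW /parab_eq0 y0.
  by rewrite /div_integrand y0 expr0n mul0r !mulr0 subrr.
Unshelve. all: by end_near. Qed.

Context (lap_ge0 : forall x, Omega x -> 0 <= laplacian u x).

(** Adding the divergence, whose integral is 0, cancels the first-order terms of the integrand and
    leaves t eta^2 / 4 times the Laplacian of u, which is nonnegative. *)
Let dPhi_ge0 (t : R) : 0 <= t -> t < r2 ->
  0 <= \int[mu]_(y in Q) dPhi_integrand t y.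
Proof.
move=> t0 tr.
have tr' : `|t| <= r2 by rewrite ger0_norm// ltW.
have E : \int[mu]_(y in Q) (\sum_(i < n) div_integrand t i y) = 0.
  by rewrite Rintegral_sumr//; [apply: big1 => i _; exact: Rintegral_div|move=> i; exact: int_div].
have iS : mu.-integrable Q (EFin \o (fun y => \sum_(i < n) div_integrand t i y)).
  rewrite (_ : _ \o _ = fun y => (\sum_(i < n) (div_integrand t i y)%:E)%E).
    by apply: (@integrable_sum _ _ _ mu Q mQ _ _ xpredT) => i _; exact: int_div.
  by apply/funext => y /=; rewrite sumEFin.
rewrite (_ : Rintegral _ _ _ = \int[mu]_(y in Q)
    (dPhi_integrand t y + \sum_(i < n) div_integrand t i y)); last first.
  by rewrite RintegralD ?E ?addr0//; exact: int_dPhi.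
apply: Rintegral_ge0 => y Qy.
rewrite (_ : _ + _ = t * laplacian u (x0 + t *: y) * (parab y ^+ 2 / 4)).
  have Ly := lap_ge0 (inO tr' (QV Qy)).
  apply: mulr_ge0; first exact: mulr_ge0.
  by apply: divr_ge0 => //; exact: sqr_ge0.
rewrite /dPhi_integrand /div_integrand /laplacian mulr_sumr !mulr_suml.
by rewrite -big_split/=; apply: eq_bigr => i _; ring.
Qed.

(** [Phi] is nondecreasing on [0, rho]; the two sides are its values at 0 and at [rho]. *)
Lemma mean_value_lt (rho : R) : 0 <= rho -> rho < r2 ->
  u x0 * \int[mu]_(y in Q) parab y <=
  \int[mu]_(y in Q) (u (x0 + rho *: y) * parab y).
Proof.
move=> rho0 rhor.
have nr (t : R) : 0 <= t -> t <= rho -> `|t| < r2.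
  by move=> t0 tr; rewrite ger0_norm// (le_lt_trans tr).
have := @ger0_derive1_le_cc R Phi 0 rho.
have H1 t : t \in `]0, rho[ -> derivable Phi t 1.
  rewrite in_itv/= => /andP[t0 t1].
  exact: (@ex_derive _ _ _ _ _ _ _ (is_derive_Phi (nr t (ltW t0) (ltW t1)))).
have H2 t : t \in `]0, rho[ -> 0 <= derive1 Phi t.
  rewrite in_itv/= => /andP[t0 t1]; rewrite derive1E.
  rewrite (@derive_val _ _ _ _ _ _ _ (is_derive_Phi (nr t (ltW t0) (ltW t1)))).
  by apply: dPhi_ge0; [exact: ltW|exact: lt_trans rhor].
have H3 : {within `[0, rho], continuous Phi}.
  apply: derivable_within_continuous => t; rewrite in_itv/= => /andP[t0 t1].
  exact: (@ex_derive _ _ _ _ _ _ _ (is_derive_Phi (nr t t0 t1))).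
move=> /(_ H1 H2 H3 0 rho).
rewrite !in_itv/= !lexx rho0 => /(_ isT isT isT).
apply: le_trans.
rewrite le_eqVlt; apply/orP; left; apply/eqP.
rewrite /Phi -RintegralZl//.
  by apply: eq_Rintegral => y _; rewrite scale0r addr0.
apply: (continuous_cube_integrable oV QV) => y _; exact: continuous_parab.
Qed.

End mean_value.

(** * Lower bounds for the quasi-norm *)

Lemma mean_value (R : realType) n (Omega : set 'rV[R]_n) (u : 'rV[R]_n -> R)
    (x0 : 'rV[R]_n) (rho r : R) :
  open Omega -> smooth_on Omega u -> (forall x, Omega x -> 0 <= laplacian u x) ->
  0 < rho -> rho < r -> (forall z, `|z - x0| < r -> Omega z) ->
  u x0 * \int[lebesgue_measure_rV n]_(y in [set y | `|y| <= 1]) parab y <=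
  \int[lebesgue_measure_rV n]_(y in [set y | `|y| <= 1])
    (u (x0 + rho *: y) * parab y).
Proof.
move=> oO su lap rho0 rhor ballO.
apply: (mean_value_lt oO su ballO (r2 := (rho + r) / 2)) => //; lra.
Qed.

Lemma Rintegral_parab_gt0 (R : realType) n :
  0 < \int[lebesgue_measure_rV (R := R) n]_(y in [set y | `|y| <= 1]) parab y.
Proof.
(* On the cube of radius [e] the squared Euclidean norm is at most n e^2 <= n e <= 1/2, so the
   kernel is at least 1/2; using n + 1 keeps [e] defined when n = 0. *)
pose e : R := (2 * n.+1%:R)^-1.
have e0 : 0 < e by rewrite invr_gt0 mulr_gt0.
have e1 : e <= 1.
  by rewrite invf_le1 ?mulr_gt0// -natrM ler1n muln_gt0.
have mQ r : 0 <= r -> measurable [set y : 'rV[R]_n | `|y| <= r].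
  exact: measurable_rV_cube.
have iQ : (lebesgue_measure_rV n).-integrable [set y : 'rV[R]_n | `|y| <= 1]
    (EFin \o @parab R n).
  apply: (continuous_cube_integrable openT) => // y _; exact: continuous_parab.
have mparab : measurable_fun setT (@parab R n).
  apply: open_continuous_measurable_rV; first exact: openT.
  by move=> y _; exact: continuous_parab.
have small (y : 'rV[R]_n) : `|y| <= e -> 2^-1 <= parab y.
  move=> ye; rewrite /parab le_max; apply/orP; right.
  suff : sqnorm y <= 2^-1 by lra.
  have ne : n%:R * e <= 2^-1.
    rewrite /e invfM mulrCA -[leRHS]mulr1 ler_wpM2l//.
    by rewrite ler_pdivrMr// mul1r ler_nat.
  apply: le_trans ne; rewrite mulr_natl -[X in _ *+ X]card_ord -sumr_const.
  apply: ler_sum => i _; rewrite -real_normK ?num_real// expr2.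
  have := rV_coord_le_norm y i; have := normr_ge0 (y ord0 i); nra.
rewrite -lte_fin /Rintegral fineK; last first.
  by apply: integrable_fin_num iQ; exact: mQ.
apply: (@lt_le_trans _ _ (\int[lebesgue_measure_rV n]_(y in [set y | (`|y| <= e)%R])
    (parab y)%:E)%E); last first.
  apply: ge0_subset_integral => //; [exact: mQ (ltW e0)|exact: mQ| | |].
  - by apply/measurable_EFinP; exact: measurable_funTS.
  - by move=> y _; rewrite lee_fin parab_ge0.
  - by move=> y /= /le_trans; apply.
apply: (@lt_le_trans _ _ (\int[lebesgue_measure_rV n]_(y in [set y | (`|y| <= e)%R])
    (2^-1)%:E)%E).
  rewrite integral_cst; last exact: mQ (ltW e0).
  by rewrite [X in (_ * X)%E](@lebesgue_rV_cube R n e e0) -EFinM lte_fin mulr_gt0 ?exprn_gt0 ?mulr_gt0.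
apply: ge0_le_integral => //; first exact: mQ (ltW e0).
- by apply/measurable_EFinP; exact: measurable_funTS.
Qed.

(** Substitute z = x + rho y and discard the part of [Omega] outside the cube, the integrand being
    nonnegative. *)
Lemma Lp_cube_le (R : realType) n (Omega : set 'rV[R]_n) (u : 'rV[R]_n -> R)
    (p : R) (x : 'rV[R]_n) (rho : R) :
  open Omega -> (forall z, Omega z -> {for z, continuous u}) ->
  0 < rho -> (forall z, `|z - x| <= rho -> Omega z) ->
  ((rho ^+ n)%:E * \int[lebesgue_measure_rV n]_(y in [set y | (`|y| <= 1)%R])
     (`|u (x + rho *: y)%R| `^ p)%:E <=
   \int[lebesgue_measure_rV n]_(z in Omega) (`|u z| `^ p)%:E)%E.
Proof.
move=> oO cu rho0 cubeO.
have mO := open_measurable_rV oO.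
have mup : measurable_fun Omega (fun z => (`|u z| `^ p)%:E).
  apply/measurable_EFinP; apply: (measurableT_comp (measurable_powR p)).
  apply: measurableT_comp => //; exact: open_continuous_measurable_rV.
rewrite [leRHS]integral_mkcond.
rewrite [leRHS](@ge0_integral_rV_affine _ _ x rho)//; last 2 first.
- exact: (measurable_restrictT _ mO).1 mup.
- by move=> z; rewrite /patch; case: ifP => // _; rewrite lee_fin powR_ge0.
rewrite lee_pmul2l ?lte_fin ?exprn_gt0// integral_mkcond.
have m1 : measurable_fun setT (fun z : 'rV[R]_n => ((fun z => (`|u z| `^ p)%:E) \_ Omega) (x + rho *: z)).
  apply: (measurableT_comp (f := (fun z => (`|u z| `^ p)%:E) \_ Omega)).
    exact: (measurable_restrictT _ mO).1 mup.
  exact: measurable_fun_rV_affine.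
have inO (z : 'rV[R]_n) : `|z| <= 1 -> Omega (x + rho *: z).
  move=> z1; apply: cubeO; rewrite addrC addKr normrZ gtr0_norm//.
  by rewrite ler_piMr// ltW.
have E : (fun y : 'rV[R]_n => (`|u (x + rho *: y)%R| `^ p)%:E) \_ [set y | `|y| <= 1] =
    (fun z : 'rV[R]_n => ((fun z => (`|u z| `^ p)%:E) \_ Omega) (x + rho *: z))
      \_ [set y : 'rV[R]_n | `|y| <= 1].
  apply/funext => y; rewrite /patch; case: ifPn => //; rewrite inE => y1.
  by rewrite mem_set//; exact: inO.
apply: ge0_le_integral => //.
- by move=> y _; rewrite /patch; case: ifP => // _; rewrite lee_fin powR_ge0.
- rewrite E; apply/(measurable_restrictT _ _).1; first exact: measurable_rV_cube.
  exact: measurable_funTS.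
- move=> y _; rewrite E /patch; case: ifP => // _.
  by case: ifP => // _; rewrite lee_fin powR_ge0.
Qed.

(* The factor K `^ (p - 1) comes from u <= (K * u x0) `^ (1 - p) * `|u| `^ p at
points where u > 0. *)
Lemma mean_value_Lp_bound (R : realType) n (Omega : set 'rV[R]_n) (u : 'rV[R]_n -> R)
    (p K : R) (x0 : 'rV[R]_n) (rho r : R) :
  open Omega -> smooth_on Omega u -> (forall x, Omega x -> 0 <= laplacian u x) ->
  0 < p < 1 -> 0 < rho -> rho < r -> (forall z, `|z - x0| < r -> Omega z) ->
  0 < u x0 -> 0 < K -> (forall z, `|z - x0| <= rho -> u z <= K * u x0) ->
  ((K `^ (p - 1) * u x0 `^ p * rho ^+ n *
    \int[lebesgue_measure_rV n]_(y in [set y | `|y| <= 1]) parab y)%:E <=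
   \int[lebesgue_measure_rV n]_(z in Omega) (`|u z| `^ p)%:E)%E.
Proof.
move=> oO su lap /andP[p0 p1] rho0 rhor ballO M0 K0 uK.
have mv := mean_value oO su lap rho0 rhor ballO.
set c := Rintegral _ _ (@parab R n) in mv *; set M := u x0 in M0 uK mv *.
have cu z : Omega z -> {for z, continuous u} by move=> Oz; exact: (su [::] z Oz).1.
have Lp := @Lp_cube_le R n Omega u p x0 rho oO cu rho0
  (fun z zr => ballO z (le_lt_trans zr rhor)).
apply: le_trans Lp.
have inO (z : 'rV[R]_n) : `|z| <= 1 -> `|x0 + rho *: z - x0| <= rho.
  move=> z1; rewrite addrC addKr normrZ gtr0_norm//.
  by rewrite ler_piMr// ltW.
have KM0 : 0 < K * M by rewrite mulr_gt0.
pose h (y : 'rV[R]_n) := `|u (x0 + rho *: y)| `^ p.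
pose V : set 'rV[R]_n := [set y | `|y| < r / rho].
have rr : 1 < r / rho by rewrite ltr_pdivlMr// mul1r.
have oV : open V.
  rewrite (_ : V = ball 0 (r / rho)); first by apply: ball_open; rewrite (lt_trans _ rr).
  by apply/seteqP; split => y /=; rewrite -ball_normE /ball_/= sub0r normrN.
have QV (y : 'rV[R]_n) : `|y| <= 1 -> V y by move=> /le_lt_trans; apply.
have cuV (y : 'rV[R]_n) : V y ->
    {for y, continuous (fun y : 'rV[R]_n => u (x0 + rho *: y))}.
  move=> Vy; apply: (@continuous_comp _ _ _ (fun y : 'rV[R]_n => x0 + rho *: y)).
    apply: continuousD; first exact: cst_continuous.
    exact: scaler_continuous.
  apply: cu; apply: ballO; rewrite addrC addKr normrZ gtr0_norm//.
  by rewrite mulrC -ltr_pdivlMr.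
have [|C HC] := @continuous_cube_bounded R n 0 1 (fun y => u (x0 + rho *: y)) ltr01.
  by move=> y; rewrite subr0 => /QV; exact: cuV.
have int_u : (lebesgue_measure_rV n).-integrable [set y : 'rV[R]_n | `|y| <= 1]
    (EFin \o (fun y : 'rV[R]_n => u (x0 + rho *: y) * parab y)).
  apply: (continuous_cube_integrable oV QV) => y Vy.
  by apply: continuousM; [exact: cuV|exact: continuous_parab].
have int_h : (lebesgue_measure_rV n).-integrable [set y : 'rV[R]_n | `|y| <= 1] (EFin \o h).
  apply: (@bounded_cube_integrable _ _ _ (C `^ p)) => //; last first.
    move=> y y1; rewrite ger0_norm ?powR_ge0//.
    apply: ge0_ler_powR; rewrite ?nnegrE ?(ltW p0)//.
      by rewrite (le_trans (normr_ge0 _) (HC y _))// subr0.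
    by apply: HC; rewrite subr0.
  apply: (@measurable_funS _ _ _ _ V) => //; first exact: open_measurable_rV.
  apply: (measurableT_comp (measurable_powR p)).
  apply: measurableT_comp => //; exact: open_continuous_measurable_rV.
have mQ : measurable [set y : 'rV[R]_n | `|y| <= 1] by exact: measurable_rV_cube.
set A := \int[lebesgue_measure_rV n]_(y in [set y | `|y| <= 1]) h y.
(* The mean value inequality with a pointwise bound on its integrand: where u <= 0 the integrand is
   nonpositive, elsewhere z = z^(1-p) z^p with z <= K M. *)
have MA : M * c <= (K * M) `^ (1 - p) * A.
  apply: le_trans mv _; rewrite -RintegralZl//.
  apply: le_Rintegral => //.
    rewrite (_ : _ \o _ = fun y => (((K * M) `^ (1 - p))%:E * (EFin \o h) y)%E)//.
    exact: integrableZl.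
  move=> y y1; have uz := uK _ (inO y y1); rewrite /h; set z := u _ in uz *.
  have [z0|z0] := leP z 0.
    apply: (@le_trans _ _ 0); first by rewrite mulr_le0_ge0// parab_ge0.
    by rewrite mulr_ge0// powR_ge0.
  apply: (@le_trans _ _ z); first by rewrite ler_piMr ?parab_le1// ltW.
  have zE : z = z `^ (1 - p) * z `^ p.
    rewrite -powRD ?subrK ?powRr1 ?(ltW z0)//.
    by rewrite (gt_eqF z0) implybT.
  rewrite gtr0_norm// [leLHS]zE ler_wpM2r ?powR_ge0//.
  by apply: ge0_ler_powR; rewrite ?nnegrE ?subr_ge0 ?(ltW p1) ?(ltW z0) ?(ltW KM0).
have AE : (\int[lebesgue_measure_rV n]_(y in [set y | (`|y| <= 1)%R]) (h y)%:E = A%:E)%E.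
  by rewrite /A /Rintegral fineK//; exact: integrable_fin_num.
rewrite [X in (_ <= _ * X)%E]AE -EFinM lee_fin.
rewrite [_ * rho ^+ n]mulrC -!mulrA ler_wpM2l ?exprn_ge0 ?(ltW rho0)//.
have KMp : 0 < (K * M) `^ (1 - p) by rewrite powR_gt0.
(* After this multiplication the powers cancel: (K M)^(1-p) K^(p-1) M^p = M. *)
rewrite -(ler_pM2l KMp); apply: le_trans MA.
rewrite mulrA mulrA ler_wpM2r//.
  by apply: Rintegral_ge0 => y _; exact: parab_ge0.
rewrite powRM ?(ltW K0) ?(ltW M0)//.
rewrite (mulrC (K `^ (1 - p))) -mulrA (mulrA (K `^ _)) -powRD; last first.
  by rewrite (gt_eqF K0) implybT.
rewrite addrA subrK subrr powRr0 mul1r -powRD ?subrK ?powRr1 ?(ltW M0)//.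
by rewrite (gt_eqF M0) implybT.
Qed.

(** At a maximum point [x0] of the weighted function [g], the mean value bound applies with radius
    d/2 and K = 2^k. Since d <= 1 and n <= k p, d^n >= d^(k p), so u(x0)^p d^n >= (u(x0) d^k)^p >=
    S^p. *)
Lemma weighted_sup_Lp_bound (R : realType) n (Omega : set 'rV[R]_n) (u : 'rV[R]_n -> R)
    (p S : R) (k : nat) (x1 x : 'rV[R]_n) (r : R) :
  open Omega -> smooth_on Omega u -> (forall x, Omega x -> 0 <= laplacian u x) ->
  0 < p < 1 -> (0 < k)%N -> n%:R <= k%:R * p ->
  0 < r -> r <= 1 -> (forall z, `|z - x1| <= r -> Omega z) ->
  0 < S -> `|x - x1| <= r -> S <= u x * (r - `|x - x1|) ^+ k ->
  (((2 ^+ k) `^ (p - 1) * S `^ p * 2^-1 ^+ n *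
    \int[lebesgue_measure_rV n]_(y in [set y | (`|y| <= 1)%R]) parab y)%:E <=
   \int[lebesgue_measure_rV n]_(z in Omega) (`|u z| `^ p)%:E)%E.
Proof.
move=> oO su lap p01 k0 nkp r0 r1 cubeO S0 xr Sx.
have /andP[p0 p1] := p01.
pose g (z : 'rV[R]_n) := u z * (r - `|z - x1|) ^+ k.
have cg (z : 'rV[R]_n) : `|z - x1| <= r -> {for z, continuous g}.
  move=> zr; apply: continuousM; first exact: (su [::] z (cubeO z zr)).1.
  apply: (@continuous_comp _ _ _ (fun z : 'rV[R]_n => r - `|z - x1|) (fun t : R => t ^+ k)).
    apply: continuousB; first exact: cst_continuous.
    apply: (@continuous_comp _ _ _ (fun z : 'rV[R]_n => z - x1) Num.norm).
      by apply: continuousB => //; exact: cst_continuous.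
    exact: norm_continuous.
  exact: exprn_continuous.
have [||x0] := @EVT_max_rV R n g [set z | `|z - x1| <= r] _ (@compact_rV_cube R n x1 r r0).
- by exists x.
- by apply: continuous_in_subspaceT => z; rewrite inE => /cg.
rewrite inE => /= x0r gmax.
set d := r - `|x0 - x1|.
have d0 : 0 <= d by rewrite subr_ge0.
have Sg : S <= u x0 * d ^+ k by apply: le_trans Sx _; apply: gmax; rewrite inE.
(* As k > 0, the weight vanishes on the boundary of the cube, where [g] could not reach S > 0. *)
have {}d0 : 0 < d.
  rewrite lt_neqAle d0 andbT; apply/negP => /eqP d0'.
  by move: Sg; rewrite -d0' expr0n eqn0Ngt k0 mulr0; apply/negP; rewrite -ltNge.
have M0 : 0 < u x0.
  by rewrite -(pmulr_lgt0 _ (exprn_gt0 k d0)); exact: lt_le_trans Sg.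
have d1 : d <= 1 by apply: le_trans r1; rewrite gerBl.
(* Within d/2 of [x0] the distance to the boundary is still at least d/2, so by maximality u exceeds
   [u x0] by a factor of at most 2^k. *)
have uK z : `|z - x0| <= d / 2 -> u z <= 2 ^+ k * u x0.
  move=> zd.
  have [uz0|uz0] := leP (u z) 0.
    by apply: le_trans uz0 _; rewrite mulr_ge0 ?exprn_ge0// ltW.
  have tri : `|z - x1| <= `|z - x0| + `|x0 - x1|.
    by rewrite -(subrKA x0 z) ler_normD.
  have dz : d / 2 <= r - `|z - x1| by move: tri zd; rewrite /d; lra.
  have zr : `|z - x1| <= r by move: dz d0; lra.
  have := gmax z; rewrite inE => /(_ zr) gz.
  have dk0 : 0 < (d / 2) ^+ k by rewrite exprn_gt0// divr_gt0.
  rewrite -(ler_pM2r dk0); apply: (@le_trans _ _ (u z * (r - `|z - x1|) ^+ k)).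
    rewrite ler_wpM2l ?(ltW uz0)// lerXn2r// nnegrE.
      by rewrite divr_ge0// ltW.
    by rewrite subr_ge0.
  apply: le_trans gz _; rewrite /g -/d expr_div_n.
  rewrite le_eqVlt; apply/orP; left; apply/eqP.
  by field; rewrite expf_neq0.
have := @mean_value_Lp_bound R n Omega u p (2 ^+ k) x0 (d / 2) d oO su lap p01.
have d20 : 0 < d / 2 by rewrite divr_gt0.
have d2d : d / 2 < d by lra.
have ballO z : `|z - x0| < d -> Omega z.
  move=> zd; apply: cubeO; have tri : `|z - x1| <= `|z - x0| + `|x0 - x1|.
    by rewrite -(subrKA x0 z) ler_normD.
  by move: tri zd; rewrite /d; lra.
move=> /(_ d20 d2d ballO M0 (exprn_gt0 k (ltr0n R 2)) uK).
apply: le_trans; rewrite lee_fin.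
rewrite ler_wpM2r//; first by apply: Rintegral_ge0 => y _; exact: parab_ge0.
rewrite -!mulrA ler_wpM2l ?powR_ge0//.
rewrite exprMn mulrA ler_wpM2r ?exprn_ge0//.
apply: (@le_trans _ _ ((u x0 * d ^+ k) `^ p)).
  apply: ge0_ler_powR; rewrite ?nnegrE ?(ltW p0) ?(ltW S0)//.
  by rewrite mulr_ge0 ?exprn_ge0 ?(ltW M0) ?(ltW d0).
rewrite powRM ?exprn_ge0 ?(ltW M0) ?(ltW d0)// ler_wpM2l ?powR_ge0//.
rewrite -!powR_mulrn ?(ltW d0)// -powRrM.
by rewrite ger_powR// d0 d1.
Qed.

(** * Comparison with a paraboloid *)

(** The first derivative vanishes at 0. If d > 0 it would be positive just to the right of 0, so f
    would exceed f(0) there by the mean value theorem. *)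
Lemma second_derivative_at_max_le0 (R : realType) (f df : R -> R) (a d : R) :
  0 < a -> (forall t : R, `|t| < a -> is_derive t 1 f (df t)) ->
  is_derive (0 : R) 1 df d -> (forall t, `|t| < a -> f t <= f 0) -> d <= 0.
Proof.
move=> a0 dff ddf fmax; rewrite leNgt; apply/negP => d0.
have in_a (t : R) : t \in `]-a, a[ -> `|t| < a by rewrite in_itv/= -ltr_norml.
have na : - a <= a by rewrite ge0_cp// ltW.
have a00 : 0 \in `]-a, a[ by rewrite in_itv/= oppr_lt0 a0.
have df0 : df 0 = 0.
  have H := @derive1_at_max R f (-a) a 0 na
    (fun t ta => @ex_derive _ _ _ _ _ _ _ (dff t (in_a t ta))) a00
    (fun t ta => fmax t (in_a t ta)).
  have a0' : `|0 : R| < a by rewrite normr0.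
  have E := @derive_val _ _ _ _ _ _ _ H.
  by rewrite (@derive_val _ _ _ _ _ _ _ (dff 0 a0')) in E.
have : h^-1 *: (df (h *: 1 + 0) - df 0) @[h --> 0^'] --> d.
  have [] := ddf; rewrite /derivable /derive /= => cv <-; exact: cv.
move=> /cvgr_gt /(_ _ d0); rewrite near_withinE => /nbhs_ballP[e /= e0 eP].
have dfpos h : 0 < h -> h < e -> 0 < df h.
  move=> h0 he; have := eP h; rewrite -ball_normE /ball_/= sub0r normrN gtr0_norm//.
  move=> /(_ he); rewrite gt_eqF// => /(_ isT).
  by rewrite addr0 df0 subr0 [h *: 1]mulr1 [_ *: _]mulrC pmulr_lgt0// invr_gt0.
pose h := Num.min (e / 2) (a / 2).
have h0 : 0 < h by rewrite lt_min !divr_gt0.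
have he : h < e by rewrite gt_min; apply/orP; left; lra.
have ha : h < a by rewrite gt_min; apply/orP; right; lra.
have fh : f 0 < f h.
  have inh (t : R) : 0 <= t -> t <= h -> `|t| < a.
    by move=> t0 th; rewrite ger0_norm// (le_lt_trans th).
  have [t||t] := @MVT R f df 0 h h0.
  - by rewrite in_itv/= => /andP[t0 th]; apply: dff; apply: inh; exact: ltW.
  - apply: derivable_within_continuous => t; rewrite in_itv/= => /andP[t0 th].
    exact: (@ex_derive _ _ _ _ _ _ _ (dff t (inh t t0 th))).
  - rewrite in_itv/= => /andP[t0 th] E; rewrite -subr_gt0 E subr0 mulr_gt0//.
    by apply: dfpos => //; exact: lt_trans he.
by have := fmax h; rewrite gtr0_norm// => /(_ ha); rewrite leNgt fh.
Qed.

(** The paraboloid |z - x1|^2 / (4 n) has Laplacian 1/2 < 1, so u minus it has no maximum at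
    Euclidean distance less than s from [x1]. Its maximum over the cube is thus at most delta - s^2
    / (4 n). *)
Lemma max_principle (R : realType) n (Omega : set 'rV[R]_n) (u : 'rV[R]_n -> R)
    (x1 x : 'rV[R]_n) (s delta : R) :
  (0 < n)%N -> open Omega -> smooth_on Omega u ->
  (forall x, Omega x -> 1 <= laplacian u x) ->
  0 < s -> (forall z, `|z - x1| <= s -> Omega z) ->
  (forall z, `|z - x1| <= s -> u z <= delta) -> `|x - x1| <= s ->
  u x <= delta - (s ^+ 2 - sqnorm (x - x1)) / (4 * n%:R).
Proof.
move=> n0 oO su lap s0 cubeO ud xs.
pose N : R := 4 * n%:R.
have N0 : 0 < N by rewrite mulr_gt0// ltr0n.
pose w (z : 'rV[R]_n) := u z - sqnorm (z - x1) / N.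
have cw (z : 'rV[R]_n) : `|z - x1| <= s -> {for z, continuous w}.
  move=> zr; apply: continuousB; first exact: (su [::] z (cubeO z zr)).1.
  apply: continuousM; last exact: cst_continuous.
  apply: (@continuous_comp _ _ _ (fun z : 'rV[R]_n => z - x1) (@sqnorm R n)).
    by apply: continuousB => //; exact: cst_continuous.
  exact: continuous_sqnorm.
have [||x0] := @EVT_max_rV R n w [set z | `|z - x1| <= s] _ (@compact_rV_cube R n x1 s s0).
- by exists x.
- by apply: continuous_in_subspaceT => z; rewrite inE => /cw.
rewrite inE => /= x0s wmax.
(* Otherwise [x0] is interior to the cube, as coordinates are bounded by the Euclidean norm, and the
   second-derivative test applies in each coordinate direction. *)
have sq0 : s ^+ 2 <= sqnorm (x0 - x1).
  rewrite leNgt; apply/negP => sq.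
  have x0s' : `|x0 - x1| < s.
    apply/rV_norm_ltP => // i.
    rewrite -(@ltr_pXn2r _ 2)// ?nnegrE ?(ltW s0)// real_normK ?num_real//.
    exact: le_lt_trans (sqnorm_coord _ i) sq.
  pose a := s - `|x0 - x1|.
  have a0 : 0 < a by rewrite subr_gt0.
  have inc (t : R) i : `|t| < a -> `|x0 + t *: delta_mx ord0 i - x1| <= s.
    move=> ta; rewrite addrAC; apply: le_trans (ler_normD _ _) _.
    have : `|t *: delta_mx ord0 i : 'rV[R]_n| <= `|t|.
      by rewrite normrZ ler_piMr// rV_norm_delta.
    by move: ta; rewrite /a; lra.
  have Ox0 : Omega x0 by exact: cubeO.
  have d2 i : partial i (partial i u) x0 <= 2 / N.
    rewrite -subr_le0.
    (* Along x0 + t e_i the squared distance to [x1] changes by 2 t b + t^2; the constant term is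
       dropped from the test function. *)
    pose b := (x0 - x1) ord0 i.
    apply: (@second_derivative_at_max_le0 R
      (fun t => u (x0 + t *: delta_mx ord0 i) - ((t * b) *+ 2 + t ^+ 2) / N)
      (fun t => partial i u (x0 + t *: delta_mx ord0 i) - (b *+ 2 + t *+ 2) / N) a) => //.
    - move=> t ta; apply: is_deriveB.
        apply: (is_derive_lineP u x0 _ t _).1.
        apply: derivableP; exact: (su [::] _ (cubeO _ (inc t i ta))).2.
      apply: is_derive1_littleo => e e0; near=> h.
      rewrite (_ : _ - _ - _ = h ^+ 2 / N); last by rewrite !mulr2n; field; rewrite gt_eqF.
      have heN : `|h| <= e * N.
        near: h; apply: (@cvgr0_norm_le _ R^o); first exact: cvg_id.
        exact: mulr_gt0.
      rewrite normrM (gtr0_norm (_ : 0 < N^-1)) ?invr_gt0// ler_pdivrMr//.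
      by rewrite expr2 normrM -mulrA (mulrC _ N) mulrA ler_wpM2r.
    - apply: is_deriveB.
        apply: (is_derive_line0P (partial i u) _ _ _).1.
        apply: derivableP; exact: (su [:: i] _ Ox0).2.
      apply: is_derive1_littleo => e e0; near=> h.
      rewrite (_ : _ - _ - _ = 0); last by rewrite !mulr2n; field; rewrite gt_eqF.
      by rewrite normr0 mulr_ge0// ltW.
    - move=> t ta; have := wmax (x0 + t *: delta_mx ord0 i).
      rewrite inE => /(_ (inc t i ta)).
      rewrite /w [_ + _ - x1]addrAC sqnorm_addZ -/b scale0r addr0 mul0r.
      rewrite mul0rn expr0n addr0 mul0r subr0 -addrA mulrDl.
      by rewrite opprD addrA -/N; lra.
  have : laplacian u x0 <= 2^-1.
    apply: (@le_trans _ _ (\sum_(i < n) 2 / N)); first exact: ler_sum.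
    rewrite sumr_const card_ord -mulr_natr le_eqVlt; apply/orP; left; apply/eqP.
    by rewrite /N; field; rewrite pnatr_eq0 -lt0n.
  have := lap x0 Ox0; lra.
have := wmax x; rewrite inE => /(_ xs); rewrite /w.
have := ud x0 x0s.
have : s ^+ 2 / N <= sqnorm (x0 - x1) / N by rewrite ler_wpM2r// invr_ge0 ltW.
rewrite -/N mulrBl; lra.
Unshelve. all: by end_near. Qed.

(** After rescaling, the integrand is at least m^p on the unit cube, which has measure 2^n. *)
Lemma Lp_ge_of_cube (R : realType) n (Omega : set 'rV[R]_n) (u : 'rV[R]_n -> R)
    (p : R) (x : 'rV[R]_n) (rho m : R) :
  open Omega -> (forall z, Omega z -> {for z, continuous u}) -> 0 <= p ->
  0 < rho -> (forall z, `|z - x| <= rho -> Omega z) ->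
  0 <= m -> (forall z, `|z - x| <= rho -> m <= `|u z|) ->
  ((rho ^+ n * (m `^ p * 2 ^+ n))%:E <=
   \int[lebesgue_measure_rV n]_(z in Omega) (`|u z| `^ p)%:E)%E.
Proof.
move=> oO cu p0 rho0 cubeO m0 mu.
apply: le_trans (Lp_cube_le p oO cu rho0 cubeO).
rewrite EFinM lee_pmul2l ?lte_fin ?exprn_gt0//.
have mQ : measurable [set y : 'rV[R]_n | `|y| <= 1] by exact: measurable_rV_cube.
have := @lebesgue_rV_cube R n 1 ltr01; rewrite mulr1 => Q2.
rewrite EFinM -[X in (_ * X <= _)%E]Q2 -(integral_cst (lebesgue_measure_rV n) mQ).
have inO (z : 'rV[R]_n) : `|z| <= 1 -> `|x + rho *: z - x| <= rho.
  move=> z1; rewrite addrC addKr normrZ gtr0_norm//.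
  by rewrite ler_piMr// ltW.
apply: ge0_le_integral => //.
- by move=> y _; rewrite lee_fin powR_ge0.
- apply: (measurable_comp (open_measurable_rV oO) (f := fun z => (`|u z| `^ p)%:E)
    (g := fun y : 'rV[R]_n => x + rho *: y)).
  + by move=> _ [y /inO y1 <-]; exact: cubeO.
  + apply/measurable_EFinP; apply: (measurableT_comp (measurable_powR p)).
    by apply: measurableT_comp => //; exact: open_continuous_measurable_rV.
  + by apply: measurable_funTS; exact: measurable_fun_rV_affine.
- move=> y /inO y1; rewrite lee_fin; apply: ge0_ler_powR; rewrite ?nnegrE//.
  exact: mu.
Qed.

(** * Choice of the constant and conclusion *)

Theorem theorem1p3 (R : realType) (n : nat) (Omega : set 'rV[R]_n)
    (Omega_neq0 : Omega !=set0) (Omega_open : open Omega)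
    (Omega_bounded : bounded_set Omega) (p : R) (p01 : 0 < p < 1) :
  exists2 c : R, 0 < c &
    forall u : 'rV[R]_n -> R,
      smooth_on Omega u ->
      (forall x, Omega x -> 1 <= laplacian u x) ->
      (c%:E <= Lp_norm Omega p u)%E.
Proof.
have [x1 Ox1] := Omega_neq0.
have /andP[p0 p1] := p01.
(* In dimension 0 the Laplacian is an empty sum, so no [u] satisfies the hypothesis and any constant
   will do. *)
have [n0|n0] := posnP n.
  exists 1 => // u _ /(_ x1 Ox1); rewrite /laplacian big1 ?ler10// => i.
  by have := leq_ltn_trans (leq0n i) (ltn_ord i); rewrite [in X in X -> _]n0.
have [e /= e0 xeO] := (nbhs_ballP _ _).1 (open_nbhs_nbhs (conj Omega_open Ox1)).
(* The half puts the closed cube inside the ball; the cap 1 is what [weighted_sup_Lp_bound]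
   requires. *)
pose r := Num.min (e / 2) 1.
have r0 : 0 < r by rewrite lt_min divr_gt0/=.
have re : r < e by rewrite gt_min; apply/orP; left; lra.
have r1 : r <= 1 by rewrite ge_min lexx orbT.
have cubeO z : `|z - x1| <= r -> Omega z.
  move=> zr; apply: xeO; rewrite -ball_normE /ball_/= distrC.
  exact: le_lt_trans re.
pose k := Num.bound (n%:R / p).
have nkp : n%:R <= k%:R * p.
  by rewrite -ler_pdivrMr// ltW// archi_boundP// divr_ge0// ltW.
have k0 : (0 < k)%N.
  rewrite lt0n; apply/eqP => k0; move: nkp.
  by rewrite k0 mul0r lern0 -leqn0 leqNgt n0.
have nR : 0 < n%:R :> R by rewrite ltr0n.
pose s := r / 2.
have s0 : 0 < s by rewrite divr_gt0.
have sr : s <= r by rewrite /s; lra.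
(* Chosen with [m] below so that delta + m = 3 s^2 / (16 n) = (s^2 - s^2 / 4) / (4 n): the
   paraboloid then forces u <= -m near the centre. *)
pose delta := s ^+ 2 / (16 * n%:R).
have delta0 : 0 < delta by rewrite divr_gt0 ?exprn_gt0 ?mulr_gt0.
(* If u > delta somewhere in the cube of radius s = r/2, the weighted function is at least [S]
   there, its distance factor being at least s. *)
pose S := delta * s ^+ k.
have S0 : 0 < S by rewrite mulr_gt0 ?exprn_gt0.
pose J1 := (2 ^+ k) `^ (p - 1) * S `^ p * 2^-1 ^+ n *
    \int[lebesgue_measure_rV (R := R) n]_(y in [set y | (`|y| <= 1)%R]) parab y.
have J10 : 0 < J1.
  by rewrite !mulr_gt0 ?exprn_gt0 ?powR_gt0 ?exprn_gt0 ?Rintegral_parab_gt0.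
(* On the cube of radius [rho] the squared Euclidean norm is at most n rho^2 = s^2 / (4 n) <= s^2 /
   4. *)
pose rho := s / (2 * n%:R).
have rho0 : 0 < rho by rewrite divr_gt0 ?mulr_gt0.
have rhos : rho <= s.
  by rewrite ler_pdivrMr ?mulr_gt0// ler_peMr ?(ltW s0)// -natrM ler1n muln_gt0.
pose m := s ^+ 2 / (8 * n%:R).
have m0 : 0 < m by rewrite divr_gt0 ?exprn_gt0 ?mulr_gt0.
pose J2 := rho ^+ n * (m `^ p * 2 ^+ n).
have J20 : 0 < J2 by rewrite !mulr_gt0 ?exprn_gt0 ?powR_gt0.
have J0 : 0 < Num.min J1 J2 by rewrite lt_min J10.
exists (Num.min J1 J2 `^ p^-1); first exact: powR_gt0.
move=> u su lap.
rewrite Lp_normE// -poweR_EFin.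
have lap0 x : Omega x -> 0 <= laplacian u x by move=> /lap; exact: le_trans.
have cu z : Omega z -> {for z, continuous u} by move=> Oz; exact: (su [::] z Oz).1.
apply: gt0_ler_poweR; rewrite ?invr_ge0 ?(ltW p0)//.
- by rewrite in_itv/= leey andbT lee_fin ltW.
- by rewrite in_itv/= leey andbT; apply: integral_ge0 => x _; rewrite lee_fin powR_ge0.
(* Either the weighted function reaches [S], and [J1] bounds the integral from below, or u <= delta
   on the smaller cube, and [J2] does. *)
have [[x xr Sx]|noS] := pselect (exists2 x, `|x - x1| <= r &
    S <= u x * (r - `|x - x1|) ^+ k).
  apply: (@le_trans _ _ J1%:E); first by rewrite lee_fin ge_min lexx.
  exact: (weighted_sup_Lp_bound Omega_open su lap0 p01 k0 nkp r0 r1 cubeO S0 xr Sx).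
apply: (@le_trans _ _ J2%:E); first by rewrite lee_fin ge_min lexx orbT.
have udelta z : `|z - x1| <= s -> u z <= delta.
  move=> zs; rewrite leNgt; apply/negP => duz; apply: noS; exists z.
    exact: le_trans sr.
  apply: ler_pM; rewrite ?exprn_ge0 ?(ltW delta0) ?(ltW s0) ?(ltW duz)//.
  have sz : s <= r - `|z - x1| by move: zs; rewrite /s; lra.
  by rewrite lerXn2r// nnegrE ?(ltW s0)// (le_trans (ltW s0)).
apply: Lp_ge_of_cube => //; rewrite ?(ltW p0) ?(ltW m0)//.
  by move=> z zr; apply: cubeO; apply: le_trans zr (le_trans rhos sr).
move=> z zr.
have zs : `|z - x1| <= s by apply: le_trans zr rhos.
have := max_principle n0 Omega_open su lap s0
  (fun z zs => cubeO z (le_trans zs sr)) udelta zs.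
have q : sqnorm (z - x1) <= s ^+ 2 / 4.
  apply: (@le_trans _ _ (\sum_(i < n) rho ^+ 2)).
    apply: ler_sum => i _; rewrite -real_normK ?num_real//.
    rewrite lerXn2r ?nnegrE ?(ltW rho0)//.
    by apply: le_trans zr; exact: rV_coord_le_norm.
  rewrite sumr_const card_ord -[_ *+ n]mulr_natr /rho.
  have -> : (s / (2 * n%:R)) ^+ 2 * n%:R = s ^+ 2 / 4 / n%:R.
    by field; rewrite gt_eqF.
  by rewrite ler_pdivrMr// ler_peMr ?divr_ge0 ?sqr_ge0// ler1n.
have : (s ^+ 2 - s ^+ 2 / 4) / (4 * n%:R) <=
    (s ^+ 2 - sqnorm (z - x1)) / (4 * n%:R).
  by rewrite ler_wpM2r ?invr_ge0 ?mulr_ge0// lerD2l lerN2.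
have -> : (s ^+ 2 - s ^+ 2 / 4) / (4 * n%:R) = delta + m.
  by rewrite /delta /m; field; rewrite gt_eqF.
move=> h1 h2; rewrite ler0_norm; last by move: h1 h2 m0; lra.
by move: h1 h2; lra.
Qed.
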